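(* Let $r_0,r_1,r_2,r_3\ge 0$ and $d\ge 0$ be integers and put $t=4d-3+r_0+r_1+r_2+r_3$. Let $S=\mathbb{C}[x_0,x_1,x_2;y_0,y_1,y_2,y_3]$ be bigraded by $\deg x_k=(1,0)$ for $k\in\{0,1,2\}$ and $\deg y_j=(-r_j,1)$ for $j\in\{0,1,2,3\}$. For general polynomials $f\in S(d,2)$ and $g\in S(t-d,2)$, the ideal in $S$ generated by the polynomials $$\frac{\partial f}{\partial x_0},\quad\frac{\partial f}{\partial x_1},\quad\frac{\partial f}{\partial x_2},\quad\frac{\partial f}{\partial y_0},\quad\frac{\partial f}{\partial y_1},\quad\frac{\partial f}{\partial y_2},\quad\frac{\partial f}{\partial y_3},\quad g$$ contains all polynomials in $S(t,4)$.
   Context: For $m,n\in\mathbb{Z}$, $S(m,n)$ denotes the finite-dimensional $\mathbb{C}$-vector space of polynomials in $S$ that are homogeneous of bidegree $(m,n)$ (including $0$) for the stated bigrading. ''For general $f\in S(d,2)$ and $g\in S(t-d,2)$'' means: for all pairs $(f,g)$ in some non-empty Zariski open subset of the affine space $S(d,2)\oplus S(t-d,2)$. *)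

(* Defs.v *)
From mathcomp Require Export all_boot all_order all_algebra.
From mathcomp Require Export reals.
From mathcomp Require Export complex.
From mathcomp Require Export mpoly.

Set Implicit Arguments.
Unset Strict Implicit.
Unset Printing Implicit Defensive.

Import GRing.Theory.

Local Open Scope ring_scope.

Section Zariski.
Variables (K : fieldType) (V : lmodType K).

(* Coordinate-free: a polynomial expression in finitely many linear forms. *)
Definition polynomial_function (F : V -> K) : Prop :=
  exists (k : nat) (P : {mpoly K[k]}) (l : 'I_k -> {scalar V}),
    forall v : V, F v = P.@[fun i => l i v].

(* Every linear form on a subspace W of V extends to V, so the polynomial
   functions on W are exactly the restrictions of those on V. For W of finite
   dimension this is therefore the usual Zariski topology of the affine
   space W; V itself may have infinite dimension. *)
Definition zariski_closed (W Z : V -> Prop) : Prop :=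
  exists E : (V -> K) -> Prop,
    (forall F, E F -> polynomial_function F) /\
    (forall v, Z v <-> W v /\ (forall F, E F -> F v = 0)).

Definition zariski_open (W U : V -> Prop) : Prop :=
  (forall v, U v -> W v) /\ zariski_closed W (fun v => W v /\ ~ U v).

Definition for_general (W P : V -> Prop) : Prop :=
  exists U : V -> Prop,
    [/\ zariski_open W U, exists v, U v & forall v, U v -> P v].

End Zariski.

Definition in_ideal_gen (A : comNzRingType) (s : seq A) (h : A) : Prop :=
  exists c : 'I_(size s) -> A, h = \sum_(i < size s) c i * s`_i.

(* The variables x_0, x_1, x_2, y_0, ..., y_3 of S have indices 0, ..., 6. *)
Definition xi (k : 'I_3) : 'I_(3 + 4) := lshift 4 k.
Definition yi (j : 'I_4) : 'I_(3 + 4) := rshift 3 j.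

Definition bidegree (r : 'I_4 -> nat) (u : 'X_{1..3 + 4}) : int * int :=
  (\sum_(k < 3) (u (xi k))%:Z - \sum_(j < 4) (r j)%:Z * (u (yi j))%:Z,
   \sum_(j < 4) (u (yi j))%:Z).

(* p \in S(m, n); it holds for p = 0. *)
Definition bihomog (K : fieldType) (r : 'I_4 -> nat) (m n : int)
    (p : {mpoly K[3 + 4]}) : bool :=
  all (fun u => bidegree r u == (m, n)) (msupp p).

Definition generators (K : fieldType) (f g : {mpoly K[3 + 4]}) :
    seq {mpoly K[3 + 4]} :=
  [seq (f^`M(xi k) : {mpoly K[3 + 4]}) | k : 'I_3] ++
  [seq (f^`M(yi j) : {mpoly K[3 + 4]}) | j : 'I_4] ++ [:: g].

(* Main.v *)
From HB Require Import structures.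
From mathcomp Require Import zify ring.
Require Import Defs.

(** The condition on [(f, g)] is open ([for_general_of_witness]), so that it is
    enough to find one good pair. Write [d_i] for [d + 2 * r i], [R] for the sum of
    the [r i] and [e] for [2 * d + R]; modulo the ideal, one has to reduce the
    monomials of degree 4 in the [y_j], with coefficients that are forms in the
    [x_k] of a given degree.

    Take [f = \sum_i a_i * y_i ^+ 2], where each [a_i] is a product of [d_i] linear
    forms in the [x_k], and where any three of the [2 * e] lines that occur are
    linearly independent. The ideal then contains all [a_i * y_i] and, for every
    direction [v], the sum of the [(d_v a_i) * y_i ^+ 2]. For such an arrangement
    everything becomes a statement on intersection points of lines: from the
    expected degree on, the products of all but two of the lines generate all
    forms ([star_configuration]), and locally at a point a single form that does
    not vanish there suffices ([forms_at_point]).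

    The coefficient of a monomial with at least three different [y_i] lies in the
    ideal of three [a_i], which have no common zero ([support3]). At a point where
    a line of [a_i] meets a line of [a_j], deriving in the direction of the second
    line isolates [y_i ^+ 3 * y_j] ([support2_odd]). For [y_i ^+ 2 * y_j ^+ 2] there
    remains one class for each such point. Deriving in the direction of a line of
    [a_i] yields linear relations between the classes of the points on this line,
    indexed by the forms of degree [e - 1]: as soon as all but [e] of these points
    have class zero, all have ([line_vanish]). If the largest [d_i] is at least
    [e], the lines of this [a_i] start the process, as they have at most [e] points
    each, and it then reaches all points. Otherwise the terms
    [b_ij * y_i * y_j] of [g] start it: [b_ij] may be any prescribed function on the
    points, and choosing its support in the shape of a staircase makes all the
    classes of the staircase vanish ([stair_vanish]). Two staircases in opposite
    directions put enough points on each line of the largest [a_i]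
    ([top_colour_vanish], [all_vanish]).

    Finally, in [y_i ^+ 4] the derivatives of [a_i] leave one class for each node
    of the arrangement of the lines of [a_i] itself, and a term [b_i * y_i ^+ 2]
    of [g] with [b_i] nonzero at these nodes kills them ([fourth_power]). *)

Set Implicit Arguments.
Unset Strict Implicit.
Unset Printing Implicit Defensive.

Import Order.TTheory GRing.Theory Num.Theory.

Local Open Scope ring_scope.

(** * Bihomogeneous polynomials *)

Section Bihomogeneous.
Variables (K : fieldType) (r : 'I_4 -> nat).
Implicit Types (p q : {mpoly K[3 + 4]}) (u v : 'X_{1..3 + 4}) (m n : int).

Lemma bihomogP m n p :
  reflect (forall u, p@_u != 0 -> bidegree r u = (m, n)) (bihomog r m n p).
Proof.
apply: (iffP allP) => h u; last by rewrite mcoeff_msupp => /h ->.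
by move=> pu; apply/eqP/h; rewrite mcoeff_msupp.
Qed.

Lemma bidegreeD u v :
  bidegree r (u + v)%MM =
  ((bidegree r u).1 + (bidegree r v).1, (bidegree r u).2 + (bidegree r v).2).
Proof.
rewrite /bidegree /=; congr (_, _).
- rewrite addrACA -opprD -!big_split /=.
  congr (_ - _); apply: eq_bigr => k _; rewrite mnmDE PoszD //.
  by rewrite mulrDr.
- by rewrite -big_split; apply: eq_bigr => k _; rewrite mnmDE PoszD.
Qed.

Lemma xi_yi k j : (xi k == yi j) = false.
Proof. by apply/negbTE/eqP => /(congr1 val) /=; have := ltn_ord k; lia. Qed.

Lemma bidegree_x k : bidegree r U_(xi k)%MM = (1, 0).
Proof.
rewrite /bidegree; congr (_, _).
- rewrite (bigD1 k) //= mnm1E eqxx big1 => [|l lk]; last first.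
    by rewrite mnm1E (inj_eq (@lshift_inj _ _)) eq_sym (negbTE lk).
  rewrite big1 ?subr0 ?addr0 // => j _.
  by rewrite mnm1E xi_yi mulr0.
- by rewrite big1 // => j _; rewrite mnm1E xi_yi.
Qed.

Lemma bidegree_y j : bidegree r U_(yi j)%MM = (- (r j)%:Z, 1).
Proof.
rewrite /bidegree; congr (_, _).
- rewrite big1 => [|k _]; last by rewrite mnm1E eq_sym xi_yi.
  rewrite (bigD1 j) //= mnm1E eqxx big1 => [|l lk]; last first.
    by rewrite mnm1E (inj_eq (@rshift_inj _ _)) eq_sym (negbTE lk) mulr0.
  by rewrite sub0r addr0 mulr1.
- rewrite (bigD1 j) //= mnm1E eqxx big1 => [|l lk]; first by rewrite addr0.
  by rewrite mnm1E (inj_eq (@rshift_inj _ _)) eq_sym (negbTE lk).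
Qed.

Lemma bihomog0 m n : bihomog r m n (0 : {mpoly K[3 + 4]}).
Proof. by rewrite /bihomog msupp0. Qed.

Lemma bihomogD m n p q :
  bihomog r m n p -> bihomog r m n q -> bihomog r m n (p + q).
Proof.
move=> /bihomogP hp /bihomogP hq; apply/bihomogP => u.
rewrite mcoeffD; have [->|/hp//] := eqVneq p@_u 0.
by rewrite add0r => /hq.
Qed.

Lemma bihomogZ m n c p : bihomog r m n p -> bihomog r m n (c *: p).
Proof.
move=> /bihomogP hp; apply/bihomogP => u.
by rewrite mcoeffZ mulf_eq0 negb_or => /andP[_ /hp].
Qed.

Lemma bihomog_sum m n (T : Type) (s : seq T) (P : pred T) (h : T -> {mpoly K[3 + 4]}) :
  (forall i, P i -> bihomog r m n (h i)) ->
  bihomog r m n (\sum_(i <- s | P i) h i).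
Proof.
by move=> hh; elim/big_ind: _ => //; [exact: bihomog0 | exact: bihomogD].
Qed.

Lemma bihomogM m n m' n' p q :
  bihomog r m n p -> bihomog r m' n' q -> bihomog r (m + m') (n + n') (p * q).
Proof.
move=> /allP hp /allP hq; apply/allP => w /msuppM_le /allpairsP[[u v] /= [hu hv ->]].
by rewrite bidegreeD (eqP (hp _ hu)) (eqP (hq _ hv)).
Qed.

Lemma bihomogX u m n : bidegree r u = (m, n) -> bihomog r m n ('X_[u] : {mpoly K[3 + 4]}).
Proof. by move=> h; rewrite /bihomog msuppX /= h eqxx. Qed.

Lemma bihomog1 : bihomog r 0 0 (1 : {mpoly K[3 + 4]}).
Proof.
rewrite -mpolyX0; apply: bihomogX; rewrite /bidegree.
by rewrite !big1 // => j _; rewrite mnmE ?mulr0.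
Qed.

Lemma bihomog_deriv i m n p : bihomog r m n p ->
  bihomog r (m - (bidegree r U_(i)%MM).1) (n - (bidegree r U_(i)%MM).2) (p^`M(i)).
Proof.
move=> /bihomogP hp; apply/bihomogP => u.
rewrite mcoeff_deriv => h; have /hp: p@_(u + U_(i)) != 0.
  by apply: contraNneq h => ->; rewrite mul0rn.
by rewrite bidegreeD; case: (bidegree r u) => a b /= [<- <-]; rewrite !addrK.
Qed.

Definition bihomog_part m n p : {mpoly K[3 + 4]} :=
  \sum_(u <- msupp p | bidegree r u == (m, n)) p@_u *: 'X_[u].

Lemma mcoeff_bihomog_part m n p u :
  (bihomog_part m n p)@_u = if bidegree r u == (m, n) then p@_u else 0.
Proof.
rewrite /bihomog_part raddf_sum /=.
under eq_bigr => v _ do rewrite mcoeffZ mcoeffX.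
have [pu|pu] := boolP (u \in msupp p); last first.
  rewrite (memN_msupp_eq0 pu) if_same big_seq_cond big1 // => v /andP[hv _].
  by case: eqP => [vu|_]; rewrite ?mulr0 //; rewrite vu (negbTE pu) in hv.
case: ifP => hu.
  rewrite big_mkcond (bigD1_seq u) ?msupp_uniq //= hu eqxx mulr1 big1 ?addr0 //.
  by move=> v /negbTE ->; rewrite mulr0 if_same.
rewrite big1 // => v hv; case: eqP => [vu|_]; rewrite ?mulr0 //.
by rewrite vu hu in hv.
Qed.

Lemma bihomog_bihomog_part m n p : bihomog r m n (bihomog_part m n p).
Proof.
apply/bihomogP => u; rewrite mcoeff_bihomog_part.
by case: (eqVneq (bidegree r u) (m, n)) => // _; rewrite eqxx.
Qed.

Lemma bihomog_partM m n m' n' p q : bihomog r m' n' q ->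
  bihomog_part (m + m') (n + n') (p * q) = bihomog_part m n p * q.
Proof.
move=> /allP hq; apply/mpolyP => w; rewrite mcoeff_bihomog_part.
rewrite !mcoeffM; case: (eqVneq (bidegree r w) _) => hw.
  apply: eq_bigr => -[[u _] [v _]] /= /eqP hwuv; rewrite mcoeff_bihomog_part.
  have [qv|qv] := boolP (v \in msupp q); last by rewrite (memN_msupp_eq0 qv) !mulr0.
  case: eqP => // hu; case: hu; move: hw; rewrite hwuv bidegreeD (eqP (hq _ qv)).
  by case: (bidegree r u) => a b /= [] /addIr -> /addIr ->.
rewrite big1 // => -[[u _] [v _]] /= /eqP hwuv; rewrite mcoeff_bihomog_part.
have [qv|qv] := boolP (v \in msupp q); last by rewrite (memN_msupp_eq0 qv) mulr0.
case: eqP => [hu|_]; last by rewrite mul0r.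
by move: hw; rewrite hwuv bidegreeD hu (eqP (hq _ qv)) eqxx.
Qed.

Lemma bihomog_part_id m n p : bihomog r m n p -> bihomog_part m n p = p.
Proof.
move=> /bihomogP hp; apply/mpolyP => u; rewrite mcoeff_bihomog_part.
by case: eqVneq => // hu; case: (eqVneq p@_u 0) => [->//|/hp/eqP]; rewrite (negbTE hu).
Qed.

Lemma bihomog_part_is_linear m n : linear (bihomog_part m n).
Proof.
move=> c p q; apply/mpolyP => u; rewrite mcoeffD mcoeffZ !mcoeff_bihomog_part.
by case: ifP; rewrite ?mcoeffD ?mcoeffZ // mulr0 addr0.
Qed.

Lemma bihomog_part_sum m n (I : Type) (s : seq I) (h : I -> {mpoly K[3 + 4]}) :
  bihomog_part m n (\sum_(i <- s) h i) = \sum_(i <- s) bihomog_part m n (h i).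
Proof.
elim/big_rec2: _ => [|i p q _ <-].
  by apply/mpolyP => u; rewrite mcoeff_bihomog_part mcoeff0 if_same.
by rewrite -[h i]scale1r bihomog_part_is_linear !scale1r.
Qed.

(** The variables [y_j] occur [n] times in total, which also bounds the exponents
    of the [x_k]: the space [S(m, n)] has a finite monomial basis. *)
Lemma finite_bidegree m n :
  exists s : seq 'X_{1..3 + 4}, uniq s /\ forall u, (u \in s) = (bidegree r u == (m, n)).
Proof.
pose B := (`|m| + (\sum_(j < 4) r j) * `|n| + `|n|).+1%N.
exists (map (@bmnm _ B) [seq u <- enum {: 'X_{1..(3 + 4) < B}} | bidegree r (bmnm u) == (m, n)]).
split.
  by rewrite map_inj_uniq ?filter_uniq -?enumT ?enum_uniq // => v w e; exact: val_inj.
move=> u; apply/mapP/idP => [[v]|hu]; first by rewrite mem_filter => /andP[? _] ->.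
suff hB : (mdeg u < B)%N by exists (BMultinom hB); rewrite // mem_filter hu mem_enum.
move/eqP: hu; rewrite /bidegree => -[hx hy].
rewrite mdegE big_split_ord /= /B ltnS.
have ey : (\sum_(j < 4) u (yi j))%N = `|n|%N.
  by apply/eqP; rewrite -eqz_nat; move: hy; rewrite -(raddf_sum Posz) => <-.
have hr : (\sum_(j < 4) r j * u (yi j) <= (\sum_(j < 4) r j) * `|n|)%N.
  rewrite big_distrl; apply: leq_sum => j _ /=; rewrite leq_mul2l -ey; apply/orP; right.
  by rewrite (bigD1 j) //= leq_addr.
have ex : (\sum_(k < 3) u (xi k))%:Z = m + (\sum_(j < 4) r j * u (yi j))%N%:Z.
  rewrite -hx (raddf_sum Posz) (raddf_sum Posz) /=.
  under [X in _ = _ - _ + X]eq_bigr => j _ do rewrite PoszM.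
  by rewrite subrK.
rewrite /yi in ey; rewrite ey leq_add2r; move: ex hr; rewrite /xi.
move: (\sum_(k < 3) _)%N (\sum_(j < 4) r j * _)%N ((\sum_(j < 4) r j) * _)%N => a b c.
clear; lia.
Qed.

End Bihomogeneous.

(** * Ideals as predicates *)

Section Ideals.
Variable A : comNzRingType.
Implicit Types (I : A -> Prop) (a b c h : A).

Definition is_ideal I :=
  [/\ I 0, forall a b, I a -> I b -> I (a + b) & forall c a, I a -> I (c * a)].

Variable I : A -> Prop.
Hypothesis idI : is_ideal I.

Lemma ideal0 : I 0. Proof. by case: idI. Qed.

Lemma idealD a b : I a -> I b -> I (a + b).
Proof. by case: idI => _ + _; apply. Qed.

Lemma idealMl c a : I a -> I (c * a).
Proof. by case: idI => _ _; apply. Qed.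

Lemma idealMr c a : I a -> I (a * c).
Proof. by rewrite mulrC; apply: idealMl. Qed.

Lemma idealN a : I a -> I (- a).
Proof. by rewrite -mulN1r; apply: idealMl. Qed.

Lemma idealB a b : I a -> I b -> I (a - b).
Proof. by move=> Ia Ib; apply: idealD => //; apply: idealN. Qed.

Lemma ideal_addr a b : I b -> I (a + b) -> I a.
Proof. by move=> Ib Iab; rewrite -(addrK b a); apply: idealB. Qed.

Lemma ideal_sum (T : Type) (s : seq T) (P : pred T) (h : T -> A) :
  (forall i, P i -> I (h i)) -> I (\sum_(i <- s | P i) h i).
Proof.
by move=> hh; elim/big_ind: _ => //; [exact: ideal0 | exact: idealD].
Qed.

Lemma ideal_sum_seq (T : eqType) (s : seq T) (P : pred T) (h : T -> A) :
  (forall i, i \in s -> P i -> I (h i)) -> I (\sum_(i <- s | P i) h i).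
Proof.
by move=> hh; rewrite big_seq_cond; apply: ideal_sum => i /andP[]; apply: hh.
Qed.

Lemma ideal_sum_one (T : eqType) (s : seq T) (h : T -> A) x :
  uniq s -> x \in s -> I (\sum_(i <- s) h i) ->
  (forall i, i \in s -> i != x -> I (h i)) -> I (h x).
Proof.
move=> us xs; rewrite (bigD1_seq x) //= => Is hh.
by apply: ideal_addr Is; apply: ideal_sum_seq.
Qed.

Lemma ideal_colon b : is_ideal (fun a => I (a * b)).
Proof.
split=> [|a a'|c a]; first by rewrite mul0r; exact: ideal0.
- by rewrite mulrDl; exact: idealD.
- by rewrite -mulrA; exact: idealMl.
Qed.

Lemma in_ideal_gen_sub (s : seq A) h :
  (forall x, x \in s -> I x) -> in_ideal_gen s h -> I h.
Proof.
move=> hs [c ->]; apply: ideal_sum => i _; apply/idealMl/hs/mem_nth.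
exact: ltn_ord.
Qed.

End Ideals.

Lemma in_ideal_gen_ideal (A : comNzRingType) (s : seq A) : is_ideal (in_ideal_gen s).
Proof.
split=> [|_ _ [c ->] [c' ->]|b _ [c ->]].
- by exists (fun=> 0); rewrite big1 // => i _; rewrite mul0r.
- exists (fun i => c i + c' i); rewrite -big_split /=.
  by apply: eq_bigr => i _; rewrite mulrDl.
- by exists (fun i => b * c i); rewrite mulr_sumr; apply: eq_bigr => i _; rewrite mulrA.
Qed.

Lemma in_ideal_gen_mem (A : comNzRingType) (s : seq A) x : x \in s -> in_ideal_gen s x.
Proof.
move=> xs; have hi : (index x s < size s)%N by rewrite index_mem.
exists (fun i => (i == Ordinal hi)%:R).
rewrite (bigD1 (Ordinal hi)) //= eqxx mul1r nth_index // big1 ?addr0 //.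
by move=> i /negbTE ->; rewrite mul0r.
Qed.

Section Generators.
Variable K : fieldType.
Implicit Types f g h : {mpoly K[3 + 4]}.

Lemma generators_deriv f g i : f^`M(i) \in generators f g.
Proof.
rewrite /generators !mem_cat; rewrite -(splitK i); case: (split i) => k /=.
- by rewrite image_f.
- by rewrite orbCA image_f.
Qed.

Lemma generators_last f g : g \in generators f g.
Proof. by rewrite /generators !mem_cat inE eqxx !orbT. Qed.

Lemma in_ideal_generators f g h :
  in_ideal_gen (generators f g) h <->
  exists c : ('I_(3 + 4) -> {mpoly K[3 + 4]}) * {mpoly K[3 + 4]},
    h = \sum_i c.1 i * f^`M(i) + c.2 * g.
Proof.
split; last first.
  case=> -[c c'] /= ->; have idI := in_ideal_gen_ideal (generators f g).
  apply: idealD => //; last exact/(idealMl idI)/in_ideal_gen_mem/generators_last.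
  by apply: ideal_sum => // i _; exact/(idealMl idI)/in_ideal_gen_mem/generators_deriv.
move: h; pose J h := exists c : ('I_(3 + 4) -> {mpoly K[3 + 4]}) * {mpoly K[3 + 4]},
  h = \sum_i c.1 i * f^`M(i) + c.2 * g.
move=> h; apply: (@in_ideal_gen_sub _ J) => [|x].
  split=> [|_ _ [c ->] [c' ->]|b _ [c ->]].
  - exists (fun=> 0, 0); rewrite big1 ?mul0r ?addr0 // => i _; exact: mul0r.
  - exists (fun i => c.1 i + c'.1 i, c.2 + c'.2); rewrite mulrDl addrACA -big_split /=.
    by congr (_ + _); apply: eq_bigr => i _; rewrite mulrDl.
  - exists (fun i => b * c.1 i, b * c.2); rewrite mulrDr mulr_sumr -mulrA.
    by congr (_ + _); apply: eq_bigr => i _; rewrite mulrA.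
have hd i : exists c : ('I_(3 + 4) -> {mpoly K[3 + 4]}) * {mpoly K[3 + 4]},
    f^`M(i) = \sum_j c.1 j * f^`M(j) + c.2 * g.
  exists (fun j => (j == i)%:R, 0); rewrite mul0r addr0 (bigD1 i) //= eqxx mul1r.
  by rewrite big1 ?addr0 // => j /negbTE ->; rewrite mul0r.
rewrite /generators !mem_cat => /or3P[/imageP[k _ ->]|/imageP[k _ ->]|] //.
rewrite inE => /eqP ->; exists (fun=> 0, 1); rewrite mul1r big1 ?add0r // => i _.
exact: mul0r.
Qed.

End Generators.

(** * A single pair suffices *)

Section Openness.
Variables (K : fieldType) (r : 'I_4 -> nat).
Local Notation S := {mpoly K[3 + 4]}.

Definition comb (c : ('I_(3 + 4) -> S) * S) (v : S * S) : S :=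
  \sum_i c.1 i * v.1^`M(i) + c.2 * v.2.

Definition comb_coeff c u (v : S * S) : K := (comb c v)@_u.

Lemma comb_coeff_is_scalar c u : scalar (comb_coeff c u).
Proof.
move=> k v w; rewrite /comb_coeff -mcoeffZ -mcoeffD; congr (_@__).
rewrite /comb /= scalerDr addrACA; congr (_ + _); last by rewrite mulrDr scalerAr.
rewrite scaler_sumr -big_split; apply: eq_bigr => i _ /=.
by rewrite mderivD mderivZ mulrDr scalerAr.
Qed.

HB.instance Definition _ c u :=
  GRing.isLinear.Build K (S * S)%type K *%R (comb_coeff c u) (comb_coeff_is_scalar c u).

Variables (d t : int).
Let W (v : S * S) := bihomog r d 2 v.1 /\ bihomog r (t - d) 2 v.2.

(** Keeping only the components of the coefficients in the complementary bidegrees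
    moves any combination of bihomogeneous generators into [S(t, 4)] and does not
    change those that are already there. *)
Definition bicomb (c : ('I_(3 + 4) -> S) * S) : ('I_(3 + 4) -> S) * S :=
  (fun i => bihomog_part r (t - (d - (bidegree r U_(i)%MM).1))
                     (4 - (2 - (bidegree r U_(i)%MM).2)) (c.1 i),
   bihomog_part r d 2 c.2).

Lemma comb_bicomb c v : W v -> comb (bicomb c) v = bihomog_part r t 4 (comb c v).
Proof.
move=> [hf hg]; rewrite /comb.
rewrite -[X in bihomog_part _ _ _ (X + _)]scale1r bihomog_part_is_linear scale1r.
rewrite bihomog_part_sum; congr (_ + _).
- apply: eq_bigr => i _ /=.
  by rewrite -(bihomog_partM _ _ _ (bihomog_deriv i hf)) !subrK.
- by rewrite -(bihomog_partM _ _ _ hg) addrC subrK.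
Qed.

(** The condition is that certain polynomials span [S(t, 4)]. Writing the monomials
    of [S(t, 4)] with bihomogeneous coefficients in terms of the generators for one
    good pair [v0], and using the same coefficients for any other pair [v], gives
    elements of the ideal of [v] in [S(t, 4)]. Their matrix in the monomial basis
    is linear in [v] and is the identity at [v0]: the ideal contains [S(t, 4)]
    wherever its determinant does not vanish. *)
Lemma for_general_of_witness (v0 : S * S) : W v0 ->
  (forall h, bihomog r t 4 h -> in_ideal_gen (generators v0.1 v0.2) h) ->
  for_general W (fun v => forall h, bihomog r t 4 h ->
    in_ideal_gen (generators v.1 v.2) h).
Proof.
move=> W0 h0; have [s [us hs]] := finite_bidegree r t 4.
pose D := size s; pose mon (i : 'I_D) := tnth (in_tuple s) i.
have hmon i : bidegree r (mon i) = (t, 4) by apply/eqP; rewrite -hs mem_tnth.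
have /fin_all_exists[c hc] : forall i, exists c, 'X_[mon i] = comb c v0.
  by move=> i; have /h0/in_ideal_generators[c] := bihomogX K (hmon i); exists c.
pose M v := \matrix_(i < D, j < D) comb_coeff (bicomb (c i)) (mon j) v.
have M0 : M v0 = 1%:M.
  apply/matrixP => i j; rewrite !mxE /comb_coeff comb_bicomb // -hc.
  rewrite bihomog_part_id; last exact/bihomogX/hmon.
  rewrite mcoeffX; congr (_%:R); rewrite -(inj_eq (f := mon)) //.
  exact/tuple_uniqP.
have polM : polynomial_function (fun v => \det (M v)).
  pose ij (k : 'I_#|{: 'I_D * 'I_D}|) : 'I_D * 'I_D := enum_val k.
  exists _, (\det (\matrix_(i < D, j < D) 'X_(enum_rank (i, j)))).
  exists (fun k => comb_coeff (bicomb (c (ij k).1)) (mon (ij k).2)) => v.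
  rewrite -det_map_mx; congr (\det _); apply/matrixP => i j.
  by rewrite !mxE /= mevalXU /ij enum_rankK.
have expand (h : S) : bihomog r t 4 h -> h = \sum_j h@_(mon j) *: 'X_[mon j].
  move=> /allP hh; rewrite [LHS]mpolyE -(big_tnth _ _ s xpredT (fun u => h@_u *: 'X_[u])).
  rewrite [RHS](bigID (mem (msupp h))) /= [X in _ + X]big1; last first.
    by move=> u /memN_msupp_eq0 ->; exact: scale0r.
  rewrite addr0 -[RHS]big_filter; apply: perm_big; apply: uniq_perm.
  - exact: msupp_uniq.
  - exact: filter_uniq.
  - by move=> u; rewrite mem_filter hs; case: (boolP (u \in msupp h)) => // /hh ->.
exists (fun v => W v /\ \det (M v) != 0); split.
- split=> [v []//|]; exists (fun F => F = fun v => \det (M v)); split=> [F ->//|v].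
  split=> [[Wv nv]|[Wv dv]]; split=> //.
  + by move=> F ->; apply/eqP/negPn/negP => dv; case: nv.
  + by move=> []; rewrite (dv _ erefl) eqxx.
- by exists v0; rewrite M0 det1 oner_eq0.
- move=> v [Wv dv] h hh; have idI := in_ideal_gen_ideal (generators v.1 v.2).
  have hM i : in_ideal_gen (generators v.1 v.2) (\sum_j M v i j *: 'X_[mon j]).
    apply/in_ideal_generators; exists (bicomb (c i)); rewrite -/(comb _ v).
    rewrite [RHS]expand; last by rewrite comb_bicomb //; exact: bihomog_bihomog_part.
    by apply: eq_bigr => j _; rewrite mxE.
  rewrite (expand h hh); apply: (ideal_sum idI) => k _.
  rewrite -mul_mpolyC; apply: (idealMl idI).
  have -> : 'X_[mon k] = \sum_i (invmx (M v) k i)%:MP * \sum_j M v i j *: 'X_[mon j].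
    under eq_bigr => i _ do rewrite mulr_sumr.
    rewrite exchange_big /= (eq_bigr (fun j => (invmx (M v) *m M v) k j *: 'X_[mon j])).
      rewrite mulVmx ?unitmxE ?unitfE //.
      rewrite (bigD1 k) //= mxE eqxx scale1r big1 ?addr0 // => j jk.
      by rewrite mxE eq_sym (negbTE jk) scale0r.
    move=> j _; rewrite mxE scaler_suml; apply: eq_bigr => i _.
    by rewrite mul_mpolyC scalerA.
  by apply: (ideal_sum idI) => i _; apply: (idealMl idI).
Qed.


End Openness.

(** * Lines in general position *)

Section Monomials.
Variable r : 'I_4 -> nat.

Lemma bidegree_x_factor u (n : nat) : bidegree r u = (n.+1%:Z, 0) ->
  exists k v, u = (U_(xi k) + v)%MM /\ bidegree r v = (n%:Z, 0).
Proof.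
move=> hu; have hy j : u (yi j) = 0%N.
  have /eqP := congr1 snd hu; rewrite /= -(raddf_sum Posz) eqz_nat.
  by rewrite sum_nat_eq0 => /forallP/(_ j)/eqP.
have [k hk] : exists k, u (xi k) != 0%N.
  apply/existsP; rewrite -negb_forall; apply/negP => /forallP h.
  have := congr1 fst hu; rewrite /= !big1 // => j _; last by rewrite (eqP (h j)).
  by rewrite hy mulr0.
have le : (U_(xi k) <= u)%MM by rewrite lep1mP.
exists k, (u - U_(xi k))%MM; split; first by rewrite addmC submK.
move: hu; rewrite -{1}(submK le) bidegreeD bidegree_x.
case: (bidegree r _) => a b /= [ha hb]; congr (_, _); lia.
Qed.

Lemma bidegree_y_factor u (m : int) (n : nat) : bidegree r u = (m, n.+1%:Z) ->
  exists j v, u = (U_(yi j) + v)%MM /\ bidegree r v = (m + (r j)%:Z, n%:Z).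
Proof.
move=> hu; have [j hj] : exists j, u (yi j) != 0%N.
  apply/existsP; rewrite -negb_forall; apply/negP => /forallP h.
  by have := congr1 snd hu; rewrite /= big1 // => j _; rewrite (eqP (h j)).
have le : (U_(yi j) <= u)%MM by rewrite lep1mP.
exists j, (u - U_(yi j))%MM; split; first by rewrite addmC submK.
move: hu; rewrite -{1}(submK le) bidegreeD bidegree_y.
case: (bidegree r _) => a b /= [ha hb]; congr (_, _); lia.
Qed.

End Monomials.

Section Lines.
Variables (K : numFieldType) (r : 'I_4 -> nat).
Local Notation S := {mpoly K[3 + 4]}.
Local Notation X k := ('X_(xi k) : S).
Implicit Types (I : S -> Prop) (s p q m n : nat) (w : S) (L M : seq nat).

(** Forms of degree [n] in the variables [x_k] alone. *)
Local Notation xform n w := (bihomog r (Posz n) 0 w).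

Lemma xformM n n' w w' : xform n w -> xform n' w' -> xform (n + n')%N (w * w').
Proof. by move=> h h'; rewrite PoszD; exact: bihomogM h h'. Qed.

(** Any three of these lines are linearly independent, by Vandermonde. *)
Definition line s : S := \sum_(k < 3) s%:R ^+ k *: X k.

Lemma xform_line s : xform 1 (line s).
Proof.
by apply: bihomog_sum => k _; apply/bihomogZ/bihomogX; rewrite bidegree_x.
Qed.

Lemma xform_line_exp s n : xform n (line s ^+ n).
Proof.
elim: n => [|n IH]; first exact: bihomog1.
by rewrite exprS -add1n; apply/xformM/IH/xform_line.
Qed.

Lemma xform_lines L : xform (size L) (\prod_(s <- L) line s).
Proof.
elim: L => [|s L IH]; first by rewrite big_nil; exact: bihomog1.
by rewrite big_cons -[size _]add1n; apply/xformM/IH/xform_line.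
Qed.

Lemma idealZ I (c : K) w : is_ideal I -> I w -> I (c *: w).
Proof. by move=> idI Iw; rewrite -mul_mpolyC; exact: idealMl. Qed.

Lemma idealZI I (c : K) w : is_ideal I -> c != 0 -> I (c *: w) -> I w.
Proof. by move=> idI c0 /(idealZ c^-1 idI); rewrite scalerA mulVf // scale1r. Qed.

Lemma xform_ind I n w : is_ideal I ->
  (forall k w', xform n w' -> I (X k * w')) -> xform n.+1 w -> I w.
Proof.
move=> idI h /allP hw; rewrite [w]mpolyE; apply: (ideal_sum_seq idI) => u /hw /eqP hu _.
apply: idealZ => //; have [k [v [-> hv]]] := bidegree_x_factor hu.
by rewrite mpolyXD; apply: h; exact: bihomogX.
Qed.

Lemma span_three_lines I p q m : is_ideal I -> uniq [:: p; q; m] ->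
  I (line p) -> I (line q) -> I (line m) -> forall k, I (X k).
Proof.
move=> idI; rewrite /= !inE !negb_or andbT => /andP[/andP[pq pm] qm] hp hq hm.
pose A := X ord0; pose B := X (@Ordinal 3 1 isT); pose C := X (@Ordinal 3 2 isT).
have lineE s : line s = A + s%:R *: B + s%:R ^+ 2 *: C.
  rewrite /line !big_ord_recr big_ord0 /= add0r expr0 expr1 -[A]scale1r.
  by congr (_ + _ + _); rewrite /A /B /C; congr (_ *: 'X_[U_(xi _)]);
    exact: val_inj.
have nz s s' : s != s' -> (s%:R - s'%:R : K) != 0 by rewrite subr_eq0 eqr_nat.
have step s s' : s != s' -> I (line s) -> I (line s') -> I (B + (s%:R + s'%:R) *: C).
  move=> /nz ss' h h'; apply: (idealZI (c := s%:R - s'%:R)) => //.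
  rewrite scalerDr scalerA [_ * (_ + _)](_ : _ = s%:R ^+ 2 - s'%:R ^+ 2); last by ring.
  suff -> : (s%:R - s'%:R) *: B + (s%:R ^+ 2 - s'%:R ^+ 2) *: C = line s - line s'.
    exact: idealB.
  by rewrite !lineE !scalerBl; ring.
have hC : I C.
  apply: (idealZI (c := q%:R - m%:R)) => //; first exact: nz.
  have := idealB idI (step _ _ pq hp hq) (step _ _ pm hp hm).
  rewrite opprD addrACA subrr add0r -scalerBl; congr (I (_ *: _)); ring.
have hB : I B by apply: ideal_addr (step _ _ pq hp hq) => //; exact: idealZ.
have hA : I A.
  have := hp; rewrite lineE -addrA; apply: ideal_addr => //.
  by apply: idealD => //; exact: idealZ.
by case=> -[|[|[|i]]] // hi.
Qed.

Lemma xform_three_lines I p q m n w : is_ideal I -> uniq [:: p; q; m] ->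
  (forall s w', s \in [:: p; q; m] -> xform n w' -> I (line s * w')) ->
  xform n.+1 w -> I w.
Proof.
move=> idI upqm h; apply: xform_ind => // k w' hw'.
apply: (@span_three_lines (fun a => I (a * w')) p q m) => //; first exact: ideal_colon.
all: by apply: h; rewrite // !inE eqxx ?orbT.
Qed.

(** The products of all but two of the lines [L] vanish at all but one of the
    intersection points of [L]; from degree [size L - 2] on, they generate all
    forms. By induction on [L]: dividing by a line [l] of [L] shows that the ideal
    contains [l] times all forms of degree [n - 1], and three such lines generate
    all linear forms. *)
Lemma star_configuration I L n k w : is_ideal I -> uniq L -> (1 < size L)%N ->
  (n + 2 = size L + k)%N ->
  (forall p q w', p \in L -> q \in L -> p != q -> xform k w' ->
     I (\prod_(s <- L | (s != p) && (s != q)) line s * w')) ->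
  xform n w -> I w.
Proof.
have [N] := ubnP (size L); elim: N L n I w => // N IH L n I w sL idI uL L1 hn h hw.
case: (ltngtP (size L) 2) => [|L2|L2]; first by lia.
- have divl (l : nat) w' : l \in L -> xform n.-1 w' -> I (line l * w').
    move=> lL hw'; rewrite mulrC.
    pose L' : seq nat := [seq s <- L | s != l].
    have sL' : size L = (size L').+1.
      by rewrite /L' -rem_filter // size_rem // prednK // ltnW.
    apply: (IH L' n.-1 (fun w => I (w * line l))) => //; try lia.
    + exact: ideal_colon.
    + exact: filter_uniq.
    + move=> p q w''; rewrite !mem_filter => /andP[pl pL] /andP[ql qL] pq hw''.
      rewrite mulrAC; have := h p q w'' pL qL pq hw''; congr (I (_ * _)).
      rewrite big_mkcond (bigD1_seq l) //= eq_sym pl eq_sym ql /= mulrC.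
      rewrite /L' [in RHS]big_filter_cond big_mkcondr /=.
      by congr (_ * _); apply: eq_bigr.
  case: L sL uL L1 hn h L2 divl => // a [//|b [//|c L]] sL uL L1 hn h L2 divl.
  have n0 : n = n.-1.+1 by move: hn => /=; lia.
  move: hw; rewrite {}n0.
  apply: (xform_three_lines idI (p := a) (q := b) (m := c)).
  + by move: uL; rewrite /= !inE !negb_or => /and4P[/and3P[-> -> _] /andP[-> _] _ _].
  + move=> s w' hs; apply: divl; move: hs; rewrite !inE.
    by case/or3P => ->; rewrite ?orbT.
- case: L uL sL L1 hn h L2 => // a [//|b []] //= uL sL L1 hn h L2.
  have := h a b w; rewrite big_seq_cond big1 ?mul1r.
    apply; rewrite ?inE ?eqxx ?orbT //.
    + by move: uL; rewrite inE andbT.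
    + by have <- : n = k by lia.
  by move=> s; rewrite !inE => /andP[/orP[]-> /=]; rewrite ?andbF.
Qed.

(** Modulo the lines [p] and [q] a form is determined by its degree and its value
    at the point where they meet, and a product of lines that avoid this point has
    a nonzero value there. *)
Lemma forms_at_point I p q M w : is_ideal I -> p != q ->
  (forall s, s \in M -> (s != p) && (s != q)) ->
  (forall n w', size M = n.+1 -> xform n w' -> I (line p * w') /\ I (line q * w')) ->
  I (\prod_(s <- M) line s) -> xform (size M) w -> I w.
Proof.
move=> idI pq; elim: M I idI w => [|m M IH] I idI w hM hpq hw0 hw.
  by move: hw0; rewrite big_nil => h1; rewrite -[w]mulr1; exact: idealMl.
have /andP[mp mq] := hM m (mem_head _ _).
apply: (xform_three_lines idI (p := p) (q := q) (m := m) _ _ hw).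
  by rewrite /= !inE negb_or pq eq_sym mp eq_sym mq.
move=> s w'; rewrite !inE => /or3P[] /eqP -> hw'; try by case: (hpq _ w' erefl hw').
rewrite mulrC; apply: (IH (fun w => I (w * line m))) => //.
- exact: ideal_colon.
- by move=> s' hs'; apply: hM; rewrite inE hs' orbT.
- move=> n w'' sM hw''; have := hpq n.+1 (w'' * line m); rewrite -!mulrA; apply.
    by rewrite /= sM.
  by rewrite -addn1; apply: xformM => //; exact: xform_line.
- by move: hw0; rewrite big_cons mulrC.
Qed.

End Lines.

(** * Diagonal quadrics with products of lines as coefficients *)

Section Diagonal.
Variables (K : numFieldType) (r : 'I_4 -> nat) (d : nat).
Local Notation S := {mpoly K[3 + 4]}.
Local Notation Y j := ('X_(yi j) : S).
Local Notation xform n w := (bihomog r (Posz n) 0 w).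
Local Notation line := (line K).
Implicit Types (i j l : 'I_4) (p q s : nat) (u w : S) (v : 'I_3 -> K).

Definition deg i : nat := (d + 2 * r i)%N.

(** All the slopes are distinct and positive, and the predecessor modulo [4] is
    the index; the line of slope [0] is kept apart, to serve as a factor that
    vanishes at none of the intersection points. *)
Definition slopes i : seq nat := [seq (4 * k + i).+1 | k <- iota 0 (deg i)].

Definition coef i : S := \prod_(s <- slopes i) line s.

Definition cof i p : S := \prod_(s <- slopes i | s != p) line s.

(** The derivative of [line s] in the direction [v]. *)
Definition slope_val v s : K := \sum_(k < 3) s%:R ^+ k * v k.

(** The derivative of [coef i] in the direction [v], by the product rule. *)
Definition grad v i : S := \sum_(p <- slopes i) slope_val v p *: cof i p.

Lemma size_slopes i : size (slopes i) = deg i.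
Proof. by rewrite size_map size_iota. Qed.

Lemma slopes_uniq i : uniq (slopes i).
Proof. by rewrite map_inj_uniq ?iota_uniq // => a b; lia. Qed.

Lemma slopes_colour i p : p \in slopes i -> (p.-1 %% 4 = i)%N.
Proof. by case/mapP => k _ -> /=; have := ltn_ord i; lia. Qed.

Lemma slopes_disjoint i j p : i != j -> p \in slopes i -> p \notin slopes j.
Proof.
by move=> ij /slopes_colour hi; apply: contraNN ij => /slopes_colour hj;
  apply/eqP/val_inj; rewrite /= -hi.
Qed.

Lemma slopes_neq i j p q : i != j -> p \in slopes i -> q \in slopes j -> p != q.
Proof. by move=> ij hp hq; apply: contraNneq (slopes_disjoint ij hp) => ->. Qed.

Lemma slopes_gt0 i p : p \in slopes i -> p != 0%N.
Proof. by case/mapP => k _ ->. Qed.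

Lemma deg_gt0 i p : p \in slopes i -> (0 < deg i)%N.
Proof. by rewrite -size_slopes; case: (slopes i). Qed.

Lemma coef_unit i : deg i = 0%N -> coef i = 1.
Proof. by rewrite -size_slopes /coef => /size0nil ->; rewrite big_nil. Qed.

Lemma coef_cof i p : p \in slopes i -> coef i = line p * cof i p.
Proof. by move=> hp; rewrite /coef (bigD1_seq p) ?slopes_uniq. Qed.

Lemma cof_other i p q : p \in slopes i -> q != p ->
  cof i q = line p * \prod_(s <- slopes i | (s != q) && (s != p)) line s.
Proof.
move=> hp qp; rewrite /cof big_mkcond (bigD1_seq p) ?slopes_uniq //= eq_sym qp.
by rewrite big_mkcondl.
Qed.

Lemma xform_coef i : xform (deg i) (coef i).
Proof. by rewrite -size_slopes; exact: xform_lines. Qed.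

Lemma cof_filter i p : cof i p = \prod_(s <- [seq s <- slopes i | s != p]) line s.
Proof. by rewrite big_filter. Qed.

Lemma size_cof i p : p \in slopes i -> size [seq s <- slopes i | s != p] = (deg i).-1.
Proof. by move=> hp; rewrite -rem_filter ?slopes_uniq // size_rem // size_slopes. Qed.

Lemma xform_cof i p : p \in slopes i -> xform (deg i).-1 (cof i p).
Proof. by move=> hp; rewrite cof_filter -(size_cof hp); exact: xform_lines. Qed.

Lemma xform_grad v i : xform (deg i).-1 (grad v i).
Proof.
rewrite /grad big_seq_cond; apply: bihomog_sum => p /andP[hp _].
exact/bihomogZ/xform_cof.
Qed.

Lemma grad_deg0 v i : deg i = 0%N -> grad v i = 0.
Proof. by rewrite -size_slopes /grad => /size0nil ->; rewrite big_nil. Qed.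

(** Every term of the derivative of [coef i] except one is divisible by [line p]. *)
Lemma grad_cof v i p (I : S -> Prop) : is_ideal I -> p \in slopes i -> I (coef i) ->
  I (grad v i * cof i p - slope_val v p *: cof i p ^+ 2).
Proof.
move=> idI hp hI; rewrite /grad (bigD1_seq p) ?slopes_uniq //= mulrDl -scalerAl.
rewrite -expr2 addrAC subrr add0r mulr_suml.
apply: (ideal_sum idI) => q qp; rewrite -scalerAl; apply: idealZ => //.
rewrite (cof_other hp qp) mulrAC -coef_cof //; exact: idealMr.
Qed.

Lemma dual_direction p q : p != q ->
  exists v, slope_val v p = 1 /\ slope_val v q = 0.
Proof.
rewrite -(eqr_nat K) -subr_eq0 => pq.
exists (fun k : 'I_3 => nth 0 [:: - q%:R / (p%:R - q%:R); (p%:R - q%:R)^-1] k).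
by rewrite /slope_val !big_ord_recr !big_ord0 /=; split; field.
Qed.

(** The generators of [I] that are assumed here are, up to constants, the
    derivatives of the diagonal form with coefficients [coef i]. *)
Variable I : S -> Prop.
Hypothesis idI : is_ideal I.
Hypothesis I_dy : forall i, I (coef i * Y i).
Hypothesis I_dx : forall v, I (\sum_i grad v i * Y i ^+ 2).

Local Notation R := (\sum_(i < 4) r i)%N.

Lemma sum_r_ge (s : seq 'I_4) : uniq s -> (\sum_(i <- s) r i <= R)%N.
Proof.
move=> us; rewrite [leqRHS](bigID (mem s)) /=.
have -> : (\sum_(i <- s) r i = \sum_(i < 4 | i \in s) r i)%N.
  rewrite -[RHS]big_filter; apply/perm_big/uniq_perm;
    rewrite ?filter_uniq ?index_enum_uniq // => i.
  by rewrite mem_filter mem_index_enum andbT.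
exact: leq_addr.
Qed.

Lemma sum_r_ge2 i j : i != j -> (r i + r j <= R)%N.
Proof.
move=> ij; have := @sum_r_ge [:: i; j]; rewrite !big_cons big_nil addn0; apply.
by rewrite /= inE ij.
Qed.

Lemma sum_r_ge3 i j l : i != j -> i != l -> j != l -> (r i + r j + r l <= R)%N.
Proof.
move=> ij il jl; have := @sum_r_ge [:: i; j; l]; rewrite !big_cons big_nil addn0 addnA.
by apply; rewrite /= !inE negb_or ij il jl.
Qed.

Lemma omit_block (J : S -> Prop) (L1 L2 : seq nat) i p q : is_ideal J -> J (coef i) ->
  p \notin slopes i -> q \notin slopes i ->
  J (\prod_(s <- L1 ++ slopes i ++ L2 | (s != p) && (s != q)) line s).
Proof.
move=> idJ Ji hp hq; rewrite !big_cat /=; apply: idealMl => //; apply: idealMr => //.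
rewrite big_seq_cond (eq_bigl (mem (slopes i))) ?(big_seq _ _ _ (slopes i)) //.
  by rewrite -big_seq.
move=> s /=; case: (boolP (s \in slopes i)) => //= hs.
by rewrite (contraNneq _ hp) ?(contraNneq _ hq) // => <-.
Qed.

(** Three of the coefficients have no common zero; the degree is beyond the socle
    of the complete intersection that they define. *)
Lemma support3 i j l m n w : i != j -> i != l -> j != l ->
  (n + 3 = 4 * d + R + (r i + r j + r l + r m))%N -> xform n w ->
  I (w * (Y i * Y j * Y l * Y m)).
Proof.
move=> ij il jl hn hw; pose J w := I (w * (Y i * Y j * Y l * Y m)).
have idJ : is_ideal J by exact: ideal_colon.
have Ji : J (coef i).
  by rewrite /J (_ : _ * _ = coef i * Y i * (Y j * Y l * Y m)); [exact: idealMr | ring].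
have Jj : J (coef j).
  by rewrite /J (_ : _ * _ = coef j * Y j * (Y i * Y l * Y m)); [exact: idealMr | ring].
have Jl : J (coef l).
  by rewrite /J (_ : _ * _ = coef l * Y l * (Y i * Y j * Y m)); [exact: idealMr | ring].
have Jm : J (coef m).
  by rewrite /J (_ : _ * _ = coef m * Y m * (Y i * Y j * Y l)); [exact: idealMr | ring].
have unit x : J (coef x) -> deg x = 0%N -> J w.
  by move=> Jx /coef_unit e; rewrite -[w]mulr1 -e; exact: idealMl idJ _ _ Jx.
have [/(unit _ Ji)//|di] := posnP (deg i).
have [/(unit _ Jj)//|dj] := posnP (deg j).
have [/(unit _ Jl)//|dl] := posnP (deg l).
have [/(unit _ Jm)//|dm] := posnP (deg m).
have rijl := sum_r_ge3 ij il jl.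
apply: (star_configuration (r := r) (L := slopes i ++ slopes j ++ slopes l)
  (n := n) (k := n + 2 - (deg i + deg j + deg l)) idJ) => //.
- rewrite !cat_uniq !slopes_uniq /= andbT; apply/andP; split; apply/hasPn => p.
    rewrite mem_cat => /orP[] hp; apply: slopes_disjoint hp; by rewrite eq_sym.
  by move=> hp; apply: slopes_disjoint hp; rewrite eq_sym.
- rewrite !size_cat !size_slopes; lia.
- rewrite !size_cat !size_slopes; move: dm; rewrite /deg; lia.
- move=> p q w' _ _ _ _; apply: idealMr => //.
  have [/andP[pi qi]|hi] := boolP ((p \notin slopes i) && (q \notin slopes i)).
    exact: (omit_block [::] _ idJ).
  have [/andP[pj qj]|hj] := boolP ((p \notin slopes j) && (q \notin slopes j)).
    exact: omit_block.
  have [/andP[pl ql]|hl] := boolP ((p \notin slopes l) && (q \notin slopes l)).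
    by have := omit_block (slopes i ++ slopes j) [::] idJ Jl pl ql; rewrite cats0 -catA.
  move: ij il jl; rewrite -!(inj_eq val_inj) /=.
  by move: hi hj hl; rewrite !negb_and !negbK => /orP[]/slopes_colour <- /orP[]/slopes_colour <-
    /orP[]/slopes_colour <-; rewrite ?eqxx.
Qed.

Lemma line_in (L : seq nat) (J : S -> Prop) p : is_ideal J -> p \in L -> J (line p) ->
  J (\prod_(s <- L) line s).
Proof. by move=> idJ hp Jp; rewrite (big_rem p) //=; exact: idealMr. Qed.

(** Lines avoiding an intersection point, in any number, obtained by completing
    those of [L] with copies of the line of slope [0]. *)
Lemma pad_lines (L : seq nat) p q n : (size L <= n)%N ->
  (forall s, s \in L -> (s != p) && (s != q)) -> p != 0%N -> q != 0%N ->
  exists M, [/\ size M = n, \prod_(s <- M) line s = \prod_(s <- L) line s * line 0 ^+ (n - size L)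
    & forall s, s \in M -> (s != p) && (s != q)].
Proof.
move=> hL hpq p0 q0; exists (L ++ nseq (n - size L) 0%N); split.
- by rewrite size_cat size_nseq subnKC.
- by rewrite big_cat big_nseq iter_mulr_1.
- move=> s; rewrite mem_cat => /orP[/hpq//|]; rewrite mem_nseq => /andP[_ /eqP ->].
  by rewrite eq_sym p0 eq_sym q0.
Qed.

Lemma omit_one_each i j p q : i != j -> p \in slopes i -> q \in slopes j ->
  \prod_(s <- slopes i ++ slopes j | (s != p) && (s != q)) line s = cof i p * cof j q.
Proof.
move=> ij pi qj; rewrite big_cat /=; congr (_ * _); rewrite big_seq_cond [RHS]big_seq_cond;
  apply: eq_bigl => s; case: (boolP (s \in _)) => //= hs.
- by rewrite (slopes_neq ij hs qj) andbT.
- by rewrite eq_sym (slopes_neq ij pi hs).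
Qed.

(** Near a common zero of the coefficients [i] and [j], the derivative along the
    direction in which only the line through it from [slopes i] varies shows that
    [Y i ^+ 3 * Y j] is in the ideal locally. *)
Lemma support2_odd i j n w : i != j ->
  (n + 3 = 4 * d + R + (3 * r i + r j))%N -> xform n w ->
  I (w * (Y i ^+ 3 * Y j)).
Proof.
move=> ij hn hw; pose J w := I (w * (Y i ^+ 3 * Y j)).
have idJ : is_ideal J by exact: ideal_colon.
have Ji : J (coef i).
  by rewrite /J (_ : _ * _ = coef i * Y i * (Y i ^+ 2 * Y j)); [exact: idealMr | ring].
have Jj : J (coef j).
  by rewrite /J (_ : _ * _ = coef j * Y j * Y i ^+ 3); [exact: idealMr | ring].
have unit x : J (coef x) -> deg x = 0%N -> J w.
  by move=> Jx /coef_unit e; rewrite -[w]mulr1 -e; exact: idealMl idJ _ _ Jx.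
have [/(unit _ Ji)//|di] := posnP (deg i).
have [/(unit _ Jj)//|dj] := posnP (deg j).
have rij := sum_r_ge2 ij.
pose k := (n + 2 - (deg i + deg j))%N.
have ek : (n + 2 = deg i + deg j + k)%N by rewrite /k; move: di; rewrite /deg; lia.
pose c := (k - (deg i).-1)%N.
have ec : (k = (deg i).-1 + c)%N by rewrite /c; move: ek di; rewrite /deg; lia.
have main p q u : p \in slopes i -> q \in slopes j -> xform c u ->
    J (cof i p ^+ 2 * cof j q * u).
  move=> pi qj hu.
  have [v [vp vq]] := dual_direction (slopes_neq ij pi qj).
  have := idealMr idI (cof i p * cof j q * u * (Y i * Y j)) (I_dx v).
  rewrite mulr_suml (bigD1 i) //= => H.
  have {}H : I (grad v i * Y i ^+ 2 * (cof i p * cof j q * u * (Y i * Y j))).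
    apply: (ideal_addr idI _ H); rewrite (bigD1 j) 1?eq_sym //=; apply: idealD => //.
      have Jj' : I (coef j * (Y j ^+ 3 * Y i)).
        by rewrite (_ : _ * _ = coef j * Y j * (Y j ^+ 2 * Y i)); [exact: idealMr | ring].
      have := grad_cof v (ideal_colon idI (Y j ^+ 3 * Y i)) qj Jj'.
      rewrite vq scale0r subr0 => /(idealMr idI (cof i p * u)); congr I; ring.
    apply: ideal_sum => // l /andP[li lj].
    have [dl|dl] := posnP (deg l); first by rewrite grad_deg0 // !mul0r; exact: ideal0.
    rewrite [_ * _](_ : _ = grad v l * cof i p * cof j q * u * (Y i * Y j * Y l * Y l));
      last by ring.
    have rijl : (r i + r j + r l <= R)%N by apply: sum_r_ge3 => //; rewrite eq_sym.
    apply: (support3 (n := (deg l).-1 + (deg i).-1 + (deg j).-1 + c)) => //;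
      try by rewrite eq_sym.
      by move: ek ec di dj dl hn; rewrite /deg; lia.
    by rewrite !(xformM, xform_grad, xform_cof).
  have {}H : J (grad v i * cof i p * (cof j q * u)).
    by move: H; rewrite /J; congr I; ring.
  have := idealMr idJ (cof j q * u) (grad_cof v idJ pi Ji).
  rewrite vp scale1r mulrBl => /(idealB idJ H); congr J; ring.
apply: (star_configuration (r := r) (L := slopes i ++ slopes j) (n := n) (k := k) idJ) => //.
- rewrite cat_uniq !slopes_uniq /= andbT; apply/hasPn => p hp.
  by apply: slopes_disjoint hp; rewrite eq_sym.
- by rewrite size_cat !size_slopes; lia.
- by rewrite size_cat !size_slopes.
have key p q w' : p \in slopes i -> q \in slopes j -> xform k w' -> J (cof i p * cof j q * w').
  move=> pi qj hw'; have pq := slopes_neq ij pi qj.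
  have [|s|||M [sM eM hM]] := @pad_lines [seq s <- slopes i | s != p] p q k.
  - by rewrite size_cof // ec leq_addr.
  - rewrite mem_filter => /andP[-> si] /=; exact: slopes_neq si qj.
  - exact: slopes_gt0 pi.
  - exact: slopes_gt0 qj.
  rewrite mulrC; apply: (forms_at_point (r := r) (I := fun w => J (w * (cof i p * cof j q)))
    (p := p) (q := q) (M := M)) => //; rewrite ?sM //.
  - exact: ideal_colon.
  - move=> _ u _ _; split.
      rewrite (_ : _ * _ = coef i * (cof j q * u)); first exact: idealMr.
      by rewrite (coef_cof pi); ring.
    rewrite (_ : _ * _ = coef j * (cof i p * u)); first exact: idealMr.
    by rewrite (coef_cof qj); ring.
  - rewrite eM -cof_filter size_cof //.
    have := main p q _ pi qj (xform_line_exp K r 0 c).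
    by rewrite ec addKn; congr J; ring.
move=> p q w'; rewrite !mem_cat => /orP[] hp /orP[] hq pq hw'.
- apply: idealMr => //.
  have := omit_block (slopes i) [::] idJ Jj (slopes_disjoint ij hp) (slopes_disjoint ij hq).
  by rewrite cats0.
- by rewrite omit_one_each //; exact: key.
- under eq_bigl => s do rewrite andbC.
  by rewrite omit_one_each //; exact: key.
- apply: idealMr => //; rewrite eq_sym in ij.
  exact: (omit_block [::] _ idJ Ji (slopes_disjoint ij hp) (slopes_disjoint ij hq)).
Qed.

(** * Classes of intersection points *)

Local Notation e := (2 * d + R)%N.

(** The class of the point where the lines [p] and [q] meet is zero: modulo
    [coef i] and [coef j], the products [cof i p * cof j q * w] with [w] of degree
    [e - 1] are the coefficients of [Y i ^+ 2 * Y j ^+ 2] that vanish at all the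
    common zeros of [coef i] and [coef j] except this point. *)
Definition vanish i j p q : Prop :=
  forall w, xform e.-1 w -> I (cof i p * cof j q * w * (Y i ^+ 2 * Y j ^+ 2)).

Definition vanish_all i j : Prop :=
  forall p q, p \in slopes i -> q \in slopes j -> vanish i j p q.

Lemma vanishC i j p q : vanish i j p q -> vanish j i q p.
Proof. by move=> h w /h; congr I; ring. Qed.

Lemma vanish_allC i j : vanish_all i j -> vanish_all j i.
Proof. by move=> h p q hp hq; apply/vanishC/h. Qed.

Lemma e_gt0 i : (0 < deg i)%N -> (0 < e)%N.
Proof.
by have := @sum_r_ge [:: i] isT; rewrite big_cons big_nil addn0 /deg; lia.
Qed.

Section Cofactors.
Variables (i j : 'I_4) (p q : nat).
Hypotheses (ij : i != j) (hp : p \in slopes i) (hq : q \in slopes j).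

Let J w := I (cof i p * cof j q * w * (Y i ^+ 2 * Y j ^+ 2)).

Lemma cofactor_ideal : is_ideal J.
Proof.
split=> [|a b Ja Jb|c a Ja]; rewrite /J; first by rewrite mulr0 mul0r; exact: ideal0.
- by rewrite mulrDr mulrDl; exact: idealD.
- by rewrite (mulrCA _ c) -mulrA; exact: idealMl.
Qed.

Lemma cofactor_linel : J (line p).
Proof.
rewrite /J (_ : _ * _ = coef i * Y i * (cof j q * (Y i * Y j ^+ 2))); first exact: idealMr.
by rewrite (coef_cof hp); ring.
Qed.

Lemma cofactor_liner : J (line q).
Proof.
rewrite /J (_ : _ * _ = coef j * Y j * (cof i p * (Y j * Y i ^+ 2))); first exact: idealMr.
by rewrite (coef_cof hq); ring.
Qed.

Lemma vanish_of_lines (M : seq nat) : size M = e.-1 ->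
  (forall s, s \in M -> (s != p) && (s != q)) -> J (\prod_(s <- M) line s) ->
  vanish i j p q.
Proof.
move=> sM hM JM w hw.
apply: (forms_at_point (r := r) cofactor_ideal (p := p) (q := q) (M := M)) => //.
- exact: slopes_neq hp hq.
- by move=> _ w' _ _; split; apply: (idealMr cofactor_ideal);
    [exact: cofactor_linel | exact: cofactor_liner].
- by rewrite sM.
Qed.

End Cofactors.

(** Deriving in the direction of the line [p] gives a linear relation between the
    classes of the intersection points on this line. *)
Lemma line_relation i p u v : p \in slopes i -> slope_val v p = 0 ->
  I (\sum_(j < 4 | j != i) \sum_(q <- slopes j)
       slope_val v q *: (cof i p * cof j q * u * (Y i ^+ 2 * Y j ^+ 2))).
Proof.
move=> hp vp; have := idealMr idI (cof i p * u * Y i ^+ 2) (I_dx v).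
rewrite mulr_suml (bigD1 i) //= addrC => H.
have Ji : I (coef i * Y i ^+ 4).
  by rewrite exprS mulrA; exact: idealMr.
have := grad_cof v (ideal_colon idI (Y i ^+ 4)) hp Ji.
rewrite vp scale0r subr0 => /(idealMr idI u) Ii.
have {}H : I (\sum_(j < 4 | j != i) grad v j * Y j ^+ 2 * (cof i p * u * Y i ^+ 2)).
  by apply: (ideal_addr idI _ H); move: Ii; congr I; ring.
move: H; congr I; apply: eq_bigr => j _.
rewrite /grad mulr_suml mulr_suml; apply: eq_bigr => q _.
by rewrite -!scalerAl; congr (_ *: _); ring.
Qed.

(** On the line [p], the points that are not yet known to vanish can be separated
    by forms of degree [e - 1] as long as there are at most [e] of them; such a
    form in [line_relation] leaves a single class. *)
Lemma line_vanish i p (U : seq nat) : p \in slopes i -> (size U <= e)%N ->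
  (forall j q, j != i -> q \in slopes j -> q \notin U -> vanish i j p q) ->
  forall j q, j != i -> q \in slopes j -> vanish i j p q.
Proof.
move=> hp sU hU j q ji hq; have [qU|] := boolP (q \in U); last exact: hU.
have ij : i != j by rewrite eq_sym.
have [|s|||M [sM eM hM]] := @pad_lines [seq s <- U | (s != p) && (s != q)] p q e.-1.
- have /e_gt0 e0 := deg_gt0 hp.
  rewrite -ltnS prednK //; apply: leq_trans sU.
  rewrite size_filter -(count_predC (fun s => (s != p) && (s != q)) U) -[ltnLHS]addn0.
  by rewrite ltn_add2l -has_count; apply/hasP; exists q => //=; rewrite eqxx andbF.
- by rewrite mem_filter => /andP[].
- exact: slopes_gt0 hp.
- exact: slopes_gt0 hq.
apply: (vanish_of_lines ij hp hq sM hM); set u := \prod_(s <- M) line s.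
have hu : xform e.-1 u by rewrite -sM; exact: xform_lines.
have [v [vq vp]] := dual_direction (slopes_neq ji hq hp).
have other j' q' : j' != i -> q' \in slopes j' -> q' != q ->
    I (slope_val v q' *: (cof i p * cof j' q' * u * (Y i ^+ 2 * Y j' ^+ 2))).
  move=> ji' hq' qq'; apply: idealZ => //.
  have [q'U|/hU] := boolP (q' \in U); last exact.
  have idJ := cofactor_ideal i j' p q'.
  rewrite /u eM; apply: (idealMr idJ); apply: (@line_in _ _ q' idJ).
    by rewrite mem_filter q'U qq' (slopes_neq ji' hq' hp).
  exact: cofactor_liner.
have := line_relation u hp vp.
rewrite (bigD1 j) //= => H.
rewrite -[_ * _ * _]scale1r -vq.
pose h q := slope_val v q *: (cof i p * cof j q * u * (Y i ^+ 2 * Y j ^+ 2)).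
apply: (ideal_sum_one idI (h := h) (slopes_uniq j) hq) => [|q' hq' qq'].
  apply: (ideal_addr idI _ H); apply: (ideal_sum idI) => j' /andP[ji' jj'].
  apply: (ideal_sum_seq idI) => q' hq' _; apply: other => //.
  exact: slopes_neq hq' hq.
exact: other.
Qed.

(** [D] lists the indices [j] for which the points on lines of [slopes i] and
    [slopes j] are not yet known to vanish. *)
Lemma colour_vanish i (D : seq 'I_4) : (\sum_(j <- D) deg j <= e)%N ->
  (forall j, j != i -> j \notin D -> vanish_all i j) ->
  forall j, j != i -> vanish_all i j.
Proof.
move=> hD hv j ji p q hp hq.
apply: (line_vanish (U := flatten [seq slopes l | l <- D]) hp) => //.
  by rewrite size_flatten sumnE !big_map; under eq_bigr do rewrite size_slopes.
move=> l q' li hq' nq'; apply: hv => //; apply: contra nq' => lD.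
by apply/flattenP; exists (slopes l) => //; exact: map_f.
Qed.

(** The points exhaust [Y i ^+ 2 * Y j ^+ 2]: this is the star configuration of the
    lines of both indices, in which two lines of the same index leave a multiple of
    the other coefficient. *)
Lemma mixed_squares i j n w : i != j -> vanish_all i j ->
  (n + 3 = 4 * d + R + (2 * r i + 2 * r j))%N -> xform n w ->
  I (w * (Y i ^+ 2 * Y j ^+ 2)).
Proof.
move=> ij hv hn hw; pose J w := I (w * (Y i ^+ 2 * Y j ^+ 2)).
have idJ : is_ideal J by exact: ideal_colon.
have Ji : J (coef i).
  by rewrite /J (_ : _ * _ = coef i * Y i * (Y i * Y j ^+ 2)); [exact: idealMr | ring].
have Jj : J (coef j).
  by rewrite /J (_ : _ * _ = coef j * Y j * (Y j * Y i ^+ 2)); [exact: idealMr | ring].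
have unit x : J (coef x) -> deg x = 0%N -> J w.
  by move=> Jx /coef_unit ex; rewrite -[w]mulr1 -ex; exact: idealMl idJ _ _ Jx.
have [/(unit _ Ji)//|di] := posnP (deg i).
have [/(unit _ Jj)//|dj] := posnP (deg j).
apply: (star_configuration (r := r) (L := slopes i ++ slopes j) (n := n) (k := e.-1) idJ) => //.
- rewrite cat_uniq !slopes_uniq /= andbT; apply/hasPn => p hp.
  by apply: slopes_disjoint hp; rewrite eq_sym.
- by rewrite size_cat !size_slopes; lia.
- have := e_gt0 di; rewrite size_cat !size_slopes /deg; lia.
move=> p q w'; rewrite !mem_cat => /orP[] hp /orP[] hq pq hw'.
- apply: idealMr => //.
  have := omit_block (slopes i) [::] idJ Jj (slopes_disjoint ij hp) (slopes_disjoint ij hq).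
  by rewrite cats0.
- by rewrite omit_one_each //; exact: hv.
- under eq_bigl => s do rewrite andbC.
  by rewrite omit_one_each //; exact: hv.
- apply: idealMr => //; rewrite eq_sym in ij.
  exact: (omit_block [::] _ idJ Ji (slopes_disjoint ij hp) (slopes_disjoint ij hq)).
Qed.

(** * Staircases *)

(** [A] is a list, and not an index, to allow for a staircase in the reverse order. *)
Definition stairs (A B : seq nat) D : seq (nat * nat) :=
  [seq x <- [seq (p, q) | p <- A, q <- B] | (index x.1 A + index x.2 B <= D)%N].

Definition stair_form i j A D : S :=
  \sum_(x <- stairs A (slopes j) D) cof i x.1 * cof j x.2 * line 0 ^+ (e.-1 - D).

(** Multiplying by the lines of [A] before [p] and of [slopes j] before [q] kills
    all the points of the staircase except those that come after [(p, q)] in both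
    directions, so that the points can be treated in decreasing order. *)
Lemma stair_vanish i j A D : i != j -> uniq A -> A =i slopes i -> (D <= e.-1)%N ->
  (forall w, xform D w -> I (stair_form i j A D * w * (Y i ^+ 2 * Y j ^+ 2))) ->
  forall p q, p \in slopes i -> q \in slopes j ->
    (index p A + index q (slopes j) <= D)%N -> vanish i j p q.
Proof.
move=> ij uA AE De hI p q; have [m] := ubnP (D - (index p A + index q (slopes j))).
elim: m p q => // m IH p q hm hp hq hpq; set B := slopes j in hm hpq IH *.
set a := index p A in hm hpq *; set b := index q B in hm hpq *.
pose M := take a A ++ take b B ++ nseq (e.-1 - (a + b)) 0%N.
have hpA : p \in A by rewrite AE.
have sa : size (take a A) = a by rewrite size_takel // index_size.
have sb : size (take b B) = b by rewrite size_takel // index_size.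
apply: (vanish_of_lines ij hp hq (M := M)).
- by rewrite !size_cat size_nseq sa sb; lia.
- move=> s; rewrite !mem_cat => /or3P[] hs.
  + have := mem_take hs; rewrite AE => si; rewrite (slopes_neq ij si hq) andbT.
    by apply: contraTneq hs => ->; rewrite in_take // ltnn.
  + have sj := mem_take hs; rewrite eq_sym (slopes_neq ij hp sj) /=.
    by apply: contraTneq hs => ->; rewrite in_take // ltnn.
  + move: hs; rewrite mem_nseq => /andP[_ /eqP ->].
    by rewrite eq_sym (slopes_gt0 hp) eq_sym (slopes_gt0 hq).
pose w := \prod_(s <- take a A) line s * \prod_(s <- take b B) line s * line 0 ^+ (D - (a + b)).
have hw : xform D w.
  have -> : D = (a + b + (D - (a + b)))%N by lia.
  apply: xformM; last exact: xform_line_exp.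
  by rewrite -{1}sa -{1}sb; apply: xformM; exact: xform_lines.
have eM : \prod_(s <- M) line s = line 0 ^+ (e.-1 - D) * w.
  rewrite /M /w !big_cat big_nseq iter_mulr_1 /=.
  have -> : (e.-1 - (a + b) = e.-1 - D + (D - (a + b)))%N by lia.
  by rewrite exprD; ring.
have hu : xform e.-1 (line 0 ^+ (e.-1 - D) * w).
  have {1}-> : e.-1 = (e.-1 - D + D)%N by lia.
  by apply: xformM => //; exact: xform_line_exp.
rewrite eM; have := hI w hw; rewrite /stair_form !mulr_suml => H.
pose T x := cof i x.1 * cof j x.2 * line 0 ^+ (e.-1 - D) * w * (Y i ^+ 2 * Y j ^+ 2).
have : I (T (p, q)); last by rewrite /T /= !mulrA.
apply: (ideal_sum_one idI (h := T) _ _ H).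
- by rewrite filter_uniq // allpairs_uniq ?slopes_uniq // => -[? ?] [? ?].
- rewrite mem_filter /= hpq; apply/allpairsP; exists (p, q); by rewrite hpA.
move=> [p' q']; rewrite mem_filter => /andP[/= hpq' /allpairsP[[p'' q''] /= [hp' hq' [ep eq]]]].
rewrite -{}ep -{}eq in hp' hq' *; rewrite xpair_eqE negb_and => ne.
have hp'i : p' \in slopes i by rewrite -AE.
rewrite /T /= -(mulrA _ _ w).
pose J w := I (cof i p' * cof j q' * w * (Y i ^+ 2 * Y j ^+ 2)).
have idJ : is_ideal J by exact: cofactor_ideal.
have Jw : J w -> J (line 0 ^+ (e.-1 - D) * w) by exact: idealMl.
have [pa|pa] := ltnP (index p' A) a.
  apply: Jw; rewrite /w -mulrA; apply: (idealMr idJ).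
  apply: (line_in idJ (p := p')); first by rewrite in_take.
  exact: cofactor_linel.
have [qb|qb] := ltnP (index q' B) b.
  apply: Jw; rewrite /w; apply: (idealMr idJ); apply: (idealMl idJ).
  apply: (line_in idJ (p := q')); first by rewrite in_take.
  exact: cofactor_liner.
have nab : (index p' A != a) || (index q' B != b).
  apply: contraTT ne; rewrite !negb_or !negbK => /andP[/eqP ea /eqP eb].
  by rewrite (@index_inj _ 0%N A p' p hp' hpA ea) (@index_inj _ 0%N B q' q hq' hq eb) !eqxx.
by apply: IH => //; move: hm hpq' hpq pa qb nab; rewrite -/B; clear; lia.
Qed.

(** * Fourth powers *)

Lemma xform_cof2 i p q : p \in slopes i -> q \in slopes i -> p != q ->
  xform (deg i - 2) (\prod_(s <- slopes i | (s != p) && (s != q)) line s).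
Proof.
move=> hp hq pq; rewrite -big_filter.
have -> : (deg i - 2)%N = size [seq s <- slopes i | (s != p) && (s != q)].
  rewrite (eq_filter (a2 := predI (predC1 q) (predC1 p))); last first.
    by move=> s; rewrite /= andbC.
  rewrite filter_predI -(rem_filter q) ?filter_uniq ?slopes_uniq // size_rem.
    by rewrite size_cof // subn2.
  by rewrite mem_filter /= eq_sym pq.
exact: xform_lines.
Qed.

Lemma coef_cof2 i p q (J : S -> Prop) s : is_ideal J -> s \in slopes i ->
  (s != p) && (s != q) -> J (line s) ->
  J (\prod_(s <- slopes i | (s != p) && (s != q)) line s).
Proof.
move=> idJ hs spq Js; rewrite -big_filter; apply: (line_in idJ (p := s)) => //.
by rewrite mem_filter spq.
Qed.

(** The remaining monomials [Y i ^+ 4]. Once the mixed squares are in the ideal,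
    the gradient of [coef i] reduces the question to the nodes of the arrangement
    [slopes i], where a power of the line of slope [0] is invertible. *)
Lemma fourth_power i n w : (forall j, j != i -> vanish_all i j) ->
  ((3 <= 3 * d + R + 2 * r i)%N -> forall u, xform (deg i) u ->
     I (line 0 ^+ (3 * d + R + 2 * r i - 3) * u * Y i ^+ 4)) ->
  (n + 3 = 4 * d + R + 4 * r i)%N -> xform n w -> I (w * Y i ^+ 4).
Proof.
move=> hv hb hn; pose J w := I (w * Y i ^+ 4).
have idJ : is_ideal J by exact: ideal_colon.
have Ji : J (coef i) by rewrite /J exprS mulrA; exact: idealMr.
have ri : (r i <= R)%N by rewrite (bigD1 i) //= leq_addr.
have Jgrad v m u : ((deg i).-1 + m = n)%N -> (0 < deg i)%N -> xform m u -> J (grad v i * u).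
  move=> hm di hu; have := idealMr idI (u * Y i ^+ 2) (I_dx v).
  rewrite mulr_suml (bigD1 i) //= => H.
  suff : I (grad v i * Y i ^+ 2 * (u * Y i ^+ 2)) by rewrite /J; congr I; ring.
  apply: (ideal_addr idI _ H); apply: (ideal_sum idI) => j ji.
  have [dj|dj] := posnP (deg j); first by rewrite grad_deg0 // !mul0r; exact: ideal0.
  rewrite [_ * _](_ : _ = (grad v j * u) * (Y i ^+ 2 * Y j ^+ 2)); last by ring.
  apply: (@mixed_squares _ _ ((deg j).-1 + m)%N); rewrite 1?eq_sym //; first exact: hv.
    by move: hm hn di dj; rewrite /deg; lia.
  by apply: xformM => //; exact: xform_grad.
case: (ltngtP (deg i) 1) => [d0|d2|d1] hw.
- have /coef_unit e1 : deg i = 0%N by lia.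
  by rewrite -/(J w) -[w]mulr1 -e1; exact: idealMl.
(* On the line [p] the other lines of [slopes i] cut out the nodes of this line. *)
- have Jcof p n' u : p \in slopes i -> ((deg i).-1 + n' = n)%N -> xform n' u -> J (u * cof i p).
    move=> hp hn'.
    apply: (star_configuration (r := r) (I := fun u => J (u * cof i p)) (L := slopes i)
      (k := (n' + 2 - deg i)%N)) => //.
    + exact: ideal_colon.
    + exact: slopes_uniq.
    + by rewrite size_slopes.
    + by rewrite size_slopes; move: hn hn' d2; rewrite /deg; lia.
    pose T p q := \prod_(s <- slopes i | (s != p) && (s != q)) line s.
    have main q w' : q \in slopes i -> p != q -> xform (n' + 2 - deg i) w' ->
        J (T p q * w' * cof i p).
      move=> hq pq hw'; have [v [vp vq]] := dual_direction pq.
      have : J (grad v i * (T p q * w')).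
        apply: (Jgrad v n') => //; first by lia.
        have -> : n' = (deg i - 2 + (n' + 2 - deg i))%N.
          by move: hn hn' d2; rewrite /deg; lia.
        by apply: xformM => //; apply: xform_cof2.
      rewrite /grad mulr_suml => H.
      have -> : T p q * w' * cof i p = slope_val v p *: cof i p * (T p q * w').
        by rewrite vp scale1r; ring.
      pose h s := slope_val v s *: cof i s * (T p q * w').
      apply: (ideal_sum_one idJ (h := h) (slopes_uniq i) hp H) => p' hp' pp'; rewrite /h.
      have [->|qq'] := eqVneq p' q; first by rewrite vq scale0r mul0r; exact: ideal0.
      have Jp : J (line p' * (slope_val v p' *: cof i p' * w')).
        rewrite -scalerAl -scalerAr mulrA -coef_cof //.
        by apply: idealZ => //; exact: idealMr.
      have := coef_cof2 (ideal_colon idJ (slope_val v p' *: cof i p' * w')) hp' _ Jp.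
      by move=> /(_ p q); rewrite pp' qq' => /(_ isT); congr J; rewrite /T; ring.
    move=> p1 p2 w' h1 h2 h12 hw'.
    have [e1|p1p] := eqVneq p1 p; first by rewrite -/(T _ _) e1; apply: main; rewrite -?e1.
    have [e2|p2p] := eqVneq p2 p.
      under eq_bigl => s do rewrite andbC.
      by rewrite -/(T _ _) e2; apply: main; rewrite -?e2 // eq_sym.
    apply: (idealMr (ideal_colon idJ (cof i p))).
    apply: (@coef_cof2 i p1 p2 (fun u => J (u * cof i p)) p) => //.
    + exact: ideal_colon.
    + by rewrite eq_sym p1p eq_sym p2p.
    + by rewrite -coef_cof.
  apply: (star_configuration (r := r) (L := slopes i) (n := n) (k := (n + 2 - deg i)%N)
    idJ) => //.
  + exact: slopes_uniq.
  + by rewrite size_slopes.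
  + by rewrite size_slopes; move: hn d2; rewrite /deg; lia.
  move=> p q w' hp hq pq hw'; set T := \prod_(s <- slopes i | _) _.
  have h3 : (3 <= 3 * d + R + 2 * r i)%N by move: d2; rewrite /deg; lia.
  have ek : (n + 2 - deg i = 3 * d + R + 2 * r i - 3 + 2)%N.
    by move: hn h3; rewrite /deg; lia.
  rewrite mulrC; apply: (forms_at_point (r := r) (I := fun u => J (u * T)) (p := p) (q := q)
    (M := nseq (n + 2 - deg i) 0%N)) => //; rewrite ?size_nseq //.
  + exact: ideal_colon.
  + move=> s; rewrite mem_nseq => /andP[_ /eqP ->].
    by rewrite eq_sym (slopes_gt0 hp) eq_sym (slopes_gt0 hq).
  + move=> m u em hu.
    have hm : ((deg i).-1 + m = n)%N by lia.
    split.
      have := Jcof _ m u hq hm hu; congr J.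
      rewrite (cof_other hp) 1?eq_sym // mulrA (mulrC u); congr (_ * _).
      by apply: eq_bigl => s; rewrite andbC.
    have := Jcof _ m u hp hm hu; congr J.
    by rewrite (cof_other hq) // mulrA (mulrC u).
  + rewrite big_nseq iter_mulr_1 ek exprD.
    have hT : xform (deg i) (line 0 ^+ 2 * T).
      rewrite {1}(_ : deg i = (2 + (deg i - 2))%N); last by lia.
      by apply: xformM; [exact: xform_line_exp | exact: xform_cof2].
    by have := hb h3 _ hT; rewrite /J mulrA.
(* For a single line the derivative of [coef i] is a nonzero constant. *)
- have [p ep] : exists p, slopes i = [:: p].
    by move: d1; rewrite -size_slopes; case: (slopes i) => // p [] // _; exists p.
  have hp : p \in slopes i by rewrite ep inE.
  have [v [vp _]] := dual_direction (slopes_gt0 hp).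
  have := Jgrad v n w; rewrite d1 add0n => /(_ erefl isT hw).
  rewrite /grad /cof ep big_seq1 vp scale1r big_cons eqxx big_nil.
  by rewrite mul1r.
Qed.

(** * Propagation from the largest coefficient *)

Section Sorted.
Variables i0 i1 i2 i3 : 'I_4.
Hypothesis enum4 : perm_eq [:: i0; i1; i2; i3] (enum 'I_4).
Hypotheses (r01 : (r i0 <= r i1)%N) (r12 : (r i1 <= r i2)%N) (r23 : (r i2 <= r i3)%N).

Lemma colours_uniq : uniq [:: i0; i1; i2; i3].
Proof. by rewrite (perm_uniq enum4) enum_uniq. Qed.

Lemma colours_mem i : i \in [:: i0; i1; i2; i3].
Proof. by rewrite (perm_mem enum4) mem_enum. Qed.

Lemma sum_r : R = (r i0 + r i1 + r i2 + r i3)%N.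
Proof.
rewrite -big_enum -(perm_big _ enum4) /= !big_cons big_nil; clear; lia.
Qed.

Hypothesis stair2 : (deg i3 < e)%N -> forall w, xform (d + r i3 + r i2)%N w ->
  I (stair_form i3 i2 (slopes i3) (d + r i3 + r i2) * w * (Y i3 ^+ 2 * Y i2 ^+ 2)).
Hypothesis stair1 : (deg i3 < e)%N -> forall w, xform (d + r i3 + r i1)%N w ->
  I (stair_form i3 i1 (rev (slopes i3)) (d + r i3 + r i1) * w * (Y i3 ^+ 2 * Y i1 ^+ 2)).

(** A line of [slopes i3] meets [2 * e - deg i3] lines of other indices. When
    [deg i3 < e], what one of the two staircases loses along [slopes i3] is gained
    by the other, and together they leave at most [e] of these points. *)
Lemma top_colour_vanish j : j != i3 -> vanish_all i3 j.
Proof.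
have := colours_uniq; rewrite /= !inE !negb_or.
move=> /and4P[/and3P[i01 i02 i03] /andP[i12 i13] i23 _].
have hR := sum_r.
have [small|large] := ltnP (deg i3) e; last first.
  move: j; apply: (@colour_vanish i3 [:: i0; i1; i2]).
    by rewrite !big_cons big_nil; move: large; rewrite /deg; lia.
  move=> j j3; rewrite !inE; have := colours_mem j; rewrite !inE.
  by rewrite (negbTE j3) orbF => ->.
move=> j3 p q hp; move: j q j3.
pose a := index p (slopes i3).
have ha : (a < deg i3)%N by rewrite -size_slopes index_mem.
have ra : index p (rev (slopes i3)) = (deg i3 - a.+1)%N.
  have hb : (deg i3 - a.+1 < size (rev (slopes i3)))%N by rewrite size_rev size_slopes; lia.
  rewrite -(index_uniq 0%N hb) ?rev_uniq ?slopes_uniq //; congr (index _ _).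
  rewrite nth_rev size_slopes; last by lia.
  by rewrite (_ : _ - _ = a)%N ?nth_index //; lia.
have D2 : (d + r i3 + r i2 <= e.-1)%N.
  by move: small hR r01 r12 r23; rewrite /deg; clear; lia.
have D1 : (d + r i3 + r i1 <= e.-1)%N.
  by move: small hR r01 r12 r23; rewrite /deg; clear; lia.
pose k2 := (d + r i3 + r i2 + 1 - a)%N.
pose k1 := (d + r i3 + r i1 + 1 - (deg i3 - a.+1))%N.
apply: (@line_vanish i3 p (slopes i0 ++ drop k2 (slopes i2) ++ drop k1 (slopes i1)) hp).
  rewrite !size_cat !size_drop !size_slopes /k1 /k2; move: small ha; rewrite /deg; lia.
have dropP k (s : seq nat) x : x \in s -> x \notin drop k s -> (index x s < k)%N.
  rewrite -{1}(cat_take_drop k s) mem_cat => /orP[xs _|->//].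
  by rewrite -in_take // (mem_take xs).
move=> j q j3 hq; rewrite !mem_cat !negb_or => /and3P[q0 q2 q1].
have := colours_mem j; rewrite !inE (negbTE j3) orbF => /or3P[] /eqP ej; subst j.
- by rewrite hq in q0.
- have := dropP _ _ _ hq q1.
  rewrite /k1 => hq1; apply: (stair_vanish _ _ _ _ (stair1 small)) => //.
  + by rewrite eq_sym.
  + by rewrite rev_uniq slopes_uniq.
  + exact: mem_rev.
  + by rewrite ra; move: hq1 ha; clear; lia.
- have := dropP _ _ _ hq q2; rewrite /k2 => hq2.
  apply: (stair_vanish _ _ _ _ (stair2 small)) => //.
  + by rewrite eq_sym.
  + exact: slopes_uniq.
  + by rewrite -/a; move: hq2; clear; lia.
Qed.

(** From [i3] the vanishing spreads to [i2], because [r i0 + r i1 <= r i2 + r i3]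
    bounds the number of lines of index [i0] or [i1] by [e], and then to [i1]; all
    pairs of distinct indices involve one of the three. *)
Lemma all_vanish i j : i != j -> vanish_all i j.
Proof.
have := colours_uniq; rewrite /= !inE !negb_or.
move=> /and4P[/and3P[i01 i02 i03] /andP[i12 i13] i23 _].
have hR := sum_r.
have v3 := top_colour_vanish.
have v2 l : l != i2 -> vanish_all i2 l.
  move: l; apply: (@colour_vanish i2 [:: i0; i1]) => [|l l2].
    by rewrite !big_cons big_nil /deg; lia.
  rewrite !inE negb_or => /andP[l0 l1]; have := colours_mem l.
  rewrite !inE (negbTE l2) (negbTE l0) (negbTE l1) => /eqP ->.
  by apply: vanish_allC; exact: v3.
have v1 l : l != i1 -> vanish_all i1 l.
  move: l; apply: (@colour_vanish i1 [:: i0]) => [|l l1].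
    by rewrite big_cons big_nil /deg; lia.
  rewrite !inE => l0; have := colours_mem l.
  rewrite !inE (negbTE l1) (negbTE l0) /= => /orP[] /eqP ->.
    by apply: vanish_allC; exact: v2.
  by apply: vanish_allC; exact: v3.
have := colours_mem i; rewrite !inE => /or4P[] /eqP -> ij; rewrite eq_sym in ij.
- apply: vanish_allC; have := colours_mem j; rewrite !inE (negbTE ij) /=.
  by case/or3P => /eqP ->; [exact: v1 | exact: v2 | exact: v3].
- exact: v1.
- exact: v2.
- exact: v3.
Qed.
End Sorted.
End Diagonal.

(** * Directional derivatives *)

Section DirectionalDerivative.
Variables (K : numFieldType) (c : 'I_(3 + 4) -> K).
Local Notation S := {mpoly K[3 + 4]}.
Implicit Types p q : S.

Definition dirder p : S := \sum_i c i *: p^`M(i).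

Lemma dirderD p q : dirder (p + q) = dirder p + dirder q.
Proof.
by rewrite /dirder -big_split; apply: eq_bigr => i _; rewrite mderivD scalerDr.
Qed.

Lemma dirderZ a p : dirder (a *: p) = a *: dirder p.
Proof.
rewrite /dirder scaler_sumr; apply: eq_bigr => i _.
by rewrite mderivZ !scalerA mulrC.
Qed.

Lemma dirderM p q : dirder (p * q) = dirder p * q + p * dirder q.
Proof.
rewrite /dirder mulr_suml mulr_sumr -big_split; apply: eq_bigr => i _.
by rewrite mderivM scalerDr scalerAl scalerAr.
Qed.

Lemma dirder0 : dirder 0 = 0.
Proof. by rewrite -[in LHS](scale0r 0) dirderZ scale0r. Qed.

Lemma dirder1 : dirder 1 = 0.
Proof. by rewrite /dirder big1 // => i _; rewrite -mpolyC1 mderivC scaler0. Qed.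

Lemma dirderX i : dirder 'X_i = (c i)%:A.
Proof.
rewrite /dirder (bigD1 i) //= big1 ?addr0 => [|j ji].
  rewrite mderivX mnm1E eqxx scale1r -mpolyX0; congr (_ *: _); congr 'X_[_].
  by apply/mnmP => j; rewrite mnmBE subnn mnm0E.
by rewrite mderivX mnm1E eq_sym (negbTE ji) scale0r scaler0.
Qed.

Lemma dirder_sum (T : Type) (s : seq T) (h : T -> S) :
  dirder (\sum_(i <- s) h i) = \sum_(i <- s) dirder (h i).
Proof. by elim/big_rec2: _ => [|i a b _ <-]; [exact: dirder0 | exact: dirderD]. Qed.

Lemma dirder_line s : dirder (line K s) = (slope_val (c \o xi) s)%:A.
Proof.
rewrite /line dirder_sum /slope_val scaler_suml; apply: eq_bigr => k _.
by rewrite dirderZ dirderX scalerA.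
Qed.

Lemma dirder_coef r d i : dirder (coef K r d i) = grad r d (c \o xi) i.
Proof.
rewrite /coef /grad /cof; elim: (slopes r d i) (slopes_uniq r d i) => [|s L IH] /=.
  by rewrite !big_nil dirder1.
move=> /andP[sL uL]; rewrite !big_cons dirderM dirder_line IH // eqxx /=.
rewrite -scalerAl mul1r; congr (_ *: _ + _).
  rewrite big_seq_cond [RHS]big_seq_cond; apply: eq_bigl => q.
  by case: eqP => [->|]; rewrite ?andbF ?andbT // (negbTE sL).
rewrite mulr_sumr big_seq [RHS]big_seq; apply: eq_bigr => q qL.
by rewrite big_cons (contraNneq _ sL) ?scalerAr // => ->.
Qed.

Lemma dirder_mul_sq p i : dirder (p * 'X_i ^+ 2) =
  dirder p * 'X_i ^+ 2 + (2 * c i) *: (p * 'X_i).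
Proof.
rewrite dirderM; congr (_ + _); rewrite expr2 dirderM dirderX -scalerAl mul1r.
by rewrite mulr_algr -scalerDl -scalerAr -mulr2n mulr_natl.
Qed.

End DirectionalDerivative.

(** * The special pair *)

Section SpecialPair.
Variables (K : numFieldType) (r : 'I_4 -> nat) (d : nat) (i1 i2 i3 : 'I_4).
Local Notation S := {mpoly K[3 + 4]}.
Local Notation Y j := ('X_(yi j) : S).
Local Notation xform n w := (bihomog r (Posz n) 0 w).
Local Notation line := (line K).
Local Notation R := (\sum_(i < 4) r i)%N.
Local Notation e := (2 * d + R)%N.

Definition special_f : S := \sum_(i < 4) coef K r d i * Y i ^+ 2.

(** The degree would be negative only when [slopes i] is empty; then [coef i] is
    [1], and zero will do. *)
Definition square_coef i : S :=
  if (3 <= 3 * d + R + 2 * r i)%N then line 0 ^+ (3 * d + R + 2 * r i - 3) else 0.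

(** When [deg r d i3] is at least [e] no points have to be prescribed, and the
    degree of the power of [line 0] in the staircase form could be negative. *)
Definition mixed_coef i j A : S :=
  if (deg r d i3 < e)%N then stair_form K r d i j A (d + r i + r j) else 0.

Definition special_g : S :=
  \sum_(i < 4) square_coef i * Y i ^+ 2
  + (mixed_coef i3 i2 (slopes r d i3) * (Y i3 * Y i2)
     + mixed_coef i3 i1 (rev (slopes r d i3)) * (Y i3 * Y i1)).

Lemma bihomog_y j : bihomog r (- (r j)%:Z) 1 (Y j).
Proof. by apply: bihomogX; rewrite bidegree_y. Qed.

Lemma bihomog_yy i j (p : S) (m : int) : bihomog r (m + (r i)%:Z + (r j)%:Z) 0 p ->
  bihomog r m 2 (p * (Y i * Y j)).
Proof.
move=> hp; have := bihomogM hp (bihomogM (bihomog_y i) (bihomog_y j)).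
by congr (is_true (bihomog r _ _ _)); lia.
Qed.

Lemma special_f_bihomog : bihomog r d%:Z 2 special_f.
Proof.
apply: bihomog_sum => i _; rewrite expr2; apply: bihomog_yy.
have := xform_coef K r d i; congr (is_true (bihomog _ _ _ _)); rewrite /deg; lia.
Qed.

Lemma xform_square_coef i : square_coef i = 0 \/
  exists2 m, (m + 3 = 3 * d + R + 2 * r i)%N & xform m (square_coef i).
Proof.
rewrite /square_coef; case: ifP => h; [right | by left].
by exists (3 * d + R + 2 * r i - 3)%N; [lia | exact: xform_line_exp].
Qed.

Lemma xform_mixed_coef j A : A =i slopes r d i3 ->
  ((deg r d i3 < e)%N -> (d + r i3 + r j < e)%N) ->
  mixed_coef i3 j A = 0 \/
  exists2 m, (m + 3 = 3 * d + R + (r i3 + r j))%N & xform m (mixed_coef i3 j A).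
Proof.
move=> AE hD; rewrite /mixed_coef; case: ifP => [/hD {}hD|_]; last by left.
rewrite /stair_form; set s := stairs _ _ _.
have hs x : x \in s -> x.1 \in slopes r d i3 /\ x.2 \in slopes r d j.
  by rewrite mem_filter => /andP[_ /allpairsP[[p q] /= [+ ? ->]]]; rewrite AE.
case es: s hs => [|x s'] hs; [left; exact: big_nil | right].
have [/deg_gt0 di /deg_gt0 dj] := hs x (mem_head _ _).
exists ((deg r d i3).-1 + (deg r d j).-1 + (e.-1 - (d + r i3 + r j)))%N.
  by move: hD di dj; rewrite /deg; clear; lia.
rewrite [X in bihomog _ _ _ X]big_seq_cond; apply: bihomog_sum => y /andP[/hs[hp hq] _].
by rewrite !(xformM, xform_cof, xform_line_exp).
Qed.


Variable i0 : 'I_4.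
Hypothesis enum4 : perm_eq [:: i0; i1; i2; i3] (enum 'I_4).
Hypotheses (r01 : (r i0 <= r i1)%N) (r12 : (r i1 <= r i2)%N) (r23 : (r i2 <= r i3)%N).

Lemma mixed_degree : (deg r d i3 < e)%N ->
  (d + r i3 + r i2 < e)%N /\ (d + r i3 + r i1 < e)%N.
Proof. by have := sum_r r enum4; move: r01 r12 r23; rewrite /deg; clear; lia. Qed.

Lemma xform_mixed2 : mixed_coef i3 i2 (slopes r d i3) = 0 \/
  exists2 m, (m + 3 = 3 * d + R + (r i3 + r i2))%N
    & xform m (mixed_coef i3 i2 (slopes r d i3)).
Proof. by apply: xform_mixed_coef => // /mixed_degree[]. Qed.

Lemma xform_mixed1 : mixed_coef i3 i1 (rev (slopes r d i3)) = 0 \/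
  exists2 m, (m + 3 = 3 * d + R + (r i3 + r i1))%N
    & xform m (mixed_coef i3 i1 (rev (slopes r d i3))).
Proof. by apply: xform_mixed_coef => [q|/mixed_degree[]//]; rewrite mem_rev. Qed.

Lemma special_g_bihomog : bihomog r (3 * d%:Z - 3 + R%:Z) 2 special_g.
Proof.
apply: bihomogD; last apply: bihomogD.
- apply: bihomog_sum => i _; rewrite expr2; apply: bihomog_yy.
  case: (xform_square_coef i) => [->|[m hm]]; first exact: bihomog0.
  by congr (is_true (bihomog _ _ _ _)); lia.
- apply: bihomog_yy; case: xform_mixed2 => [->|[m hm]]; first exact: bihomog0.
  by congr (is_true (bihomog _ _ _ _)); lia.
- apply: bihomog_yy; case: xform_mixed1 => [->|[m hm]]; first exact: bihomog0.
  by congr (is_true (bihomog _ _ _ _)); lia.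
Qed.

Local Notation I := (in_ideal_gen (generators special_f special_g)).

Let idI : is_ideal I. Proof. exact: in_ideal_gen_ideal. Qed.

Lemma special_dirder c : I (dirder c special_f).
Proof.
apply: (ideal_sum idI) => i _; apply: (idealZ _ idI).
exact/in_ideal_gen_mem/generators_deriv.
Qed.

Lemma dirder_special_f c : dirder c special_f =
  \sum_i (grad r d (c \o xi) i * Y i ^+ 2 + (2 * c (yi i)) *: (coef K r d i * Y i)).
Proof.
by rewrite /special_f dirder_sum; apply: eq_bigr => i _; rewrite dirder_mul_sq dirder_coef.
Qed.

Lemma special_dy i : I (coef K r d i * Y i).
Proof.
have := special_dirder (fun l => (l == yi i)%:R); rewrite dirder_special_f.
rewrite (bigD1 i) //= eqxx mulr1 big1 => [|j ji].
  rewrite addr0 /grad big1 => [|p _].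
    by rewrite mul0r add0r => /(idealZI idI); apply; rewrite pnatr_eq0.
  by rewrite /slope_val big1 ?scale0r // => k _; rewrite /= xi_yi mulr0.
rewrite (inj_eq (@rshift_inj _ _)) (negbTE ji) mulr0 scale0r addr0 /grad big1 ?mul0r // => p _.
by rewrite /slope_val big1 ?scale0r // => k _; rewrite /= xi_yi mulr0.
Qed.

Lemma special_dx v : I (\sum_i grad r d v i * Y i ^+ 2).
Proof.
pose c (l : 'I_(3 + 4)) := if split l is inl k then v k else 0.
have cx : c \o xi =1 v by move=> k; rewrite /c /= /xi (unsplitK (inl k)).
have := special_dirder c; rewrite dirder_special_f; congr I; apply: eq_bigr => i _.
rewrite /c /yi (unsplitK (inr i)) mulr0 scale0r addr0; congr (_ * _).
apply: eq_bigr => p _; congr (_ *: _); apply: eq_bigr => k _; congr (_ * _).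
exact: cx.
Qed.

(** The monomials with two odd exponents already lie in the ideal of the derivatives
    of [special_f], so that only the squares in [Y i * Y j * special_g] and
    [Y i ^+ 2 * special_g] matter. *)
Lemma special_odd i j l n w : i != j ->
  (n + 3 = 4 * d + R + (2 * r l + (r i + r j)))%N -> xform n w ->
  I (w * (Y l ^+ 2 * (Y i * Y j))).
Proof.
move=> ij hn hw; have [li|li] := eqVneq l i.
  have := support2_odd idI special_dy special_dx ij (n := n) (w := w).
  rewrite li => h; have : I (w * (Y i ^+ 3 * Y j)) by apply: h => //; rewrite hn li; lia.
  by congr I; ring.
have [lj|lj] := eqVneq l j.
  have := support2_odd idI special_dy special_dx (i := j) (j := i) (n := n) (w := w).
  rewrite lj eq_sym => h; have : I (w * (Y j ^+ 3 * Y i)) by apply: h => //; rewrite hn lj; lia.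
  by congr I; ring.
have := support3 idI special_dy ij (l := l) (m := l) (n := n) (w := w).
rewrite eq_sym li eq_sym lj => h.
have : I (w * (Y i * Y j * Y l * Y l)) by apply: h => //; lia.
by congr I; ring.
Qed.

Lemma special_g_mul w :
  I ((\sum_i square_coef i * Y i ^+ 2) * w
     + (mixed_coef i3 i2 (slopes r d i3) * (Y i3 * Y i2) * w
        + mixed_coef i3 i1 (rev (slopes r d i3)) * (Y i3 * Y i1) * w)).
Proof.
rewrite -!mulrDl; apply: (idealMr idI).
exact/in_ideal_gen_mem/generators_last.
Qed.

Lemma square_coef_mul i i' j D w : i' != j -> xform D w ->
  (D = d + (r i' + r j))%N -> I (square_coef i * w * (Y i ^+ 2 * (Y i' * Y j))).
Proof.
move=> ij hw hD; case: (xform_square_coef i) => [->|[m hm hs]].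
  by rewrite !mul0r; exact: ideal0.
by apply: (special_odd (n := (m + D)%N)) => //; [lia | exact: xformM].
Qed.

Lemma mixed2_mul i j l D w : i != j -> xform D w ->
  (D + (r i3 + r i2) = d + (2 * r l + (r i + r j)))%N ->
  I (mixed_coef i3 i2 (slopes r d i3) * w * (Y l ^+ 2 * (Y i * Y j))).
Proof.
move=> ij hw hD; case: xform_mixed2 => [->|[m hm hs]].
  by rewrite !mul0r; exact: ideal0.
by apply: (special_odd (n := (m + D)%N)) => //; [lia | exact: xformM].
Qed.

Lemma mixed1_mul i j l D w : i != j -> xform D w ->
  (D + (r i3 + r i1) = d + (2 * r l + (r i + r j)))%N ->
  I (mixed_coef i3 i1 (rev (slopes r d i3)) * w * (Y l ^+ 2 * (Y i * Y j))).
Proof.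
move=> ij hw hD; case: xform_mixed1 => [->|[m hm hs]].
  by rewrite !mul0r; exact: ideal0.
by apply: (special_odd (n := (m + D)%N)) => //; [lia | exact: xformM].
Qed.

Lemma special_vanish i j : i != j -> vanish_all r d I i j.
Proof.
have := colours_uniq enum4; rewrite /= !inE !negb_or.
move=> /and4P[/and3P[i01 i02 i03] /andP[i12 i13] i23 _].
have i32 : i3 != i2 by rewrite eq_sym.
have i31 : i3 != i1 by rewrite eq_sym.
have sq j' D w : i3 != j' -> xform D w -> (D = d + r i3 + r j')%N ->
    I ((\sum_i square_coef i * Y i ^+ 2) * (w * (Y i3 * Y j'))).
  move=> j3 hw hD; rewrite mulr_suml; apply: (ideal_sum idI) => l _.
  have := square_coef_mul l j3 hw; rewrite hD -addnA => /(_ erefl).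
  by congr I; ring.
apply: (all_vanish idI special_dy special_dx enum4 r01 r12 r23) => small w hw.
- have := special_g_mul (w * (Y i3 * Y i2)).
  rewrite addrC => /(ideal_addr idI (sq _ _ _ i32 hw erefl)) H.
  have m1 : I (mixed_coef i3 i1 (rev (slopes r d i3)) * (Y i3 * Y i1) * (w * (Y i3 * Y i2))).
    have : I (mixed_coef i3 i1 (rev (slopes r d i3)) * w * (Y i3 ^+ 2 * (Y i1 * Y i2))).
      by apply: (mixed1_mul i12 hw); clear; lia.
    by congr I; ring.
  by move: (ideal_addr idI m1 H); rewrite /mixed_coef small; congr I; ring.
- have := special_g_mul (w * (Y i3 * Y i1)).
  rewrite addrC => /(ideal_addr idI (sq _ _ _ i31 hw erefl)) H.
  have m2 : I (mixed_coef i3 i2 (slopes r d i3) * (Y i3 * Y i2) * (w * (Y i3 * Y i1))).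
    have : I (mixed_coef i3 i2 (slopes r d i3) * w * (Y i3 ^+ 2 * (Y i1 * Y i2))).
      by apply: (mixed2_mul i12 hw); clear; lia.
    by congr I; ring.
  rewrite addrC in H.
  by move: (ideal_addr idI m2 H); rewrite /mixed_coef small; congr I; ring.
Qed.

Lemma special_fourth i n w : (n + 3 = 4 * d + R + 4 * r i)%N -> xform n w -> I (w * Y i ^+ 4).
Proof.
have := colours_uniq enum4; rewrite /= !inE !negb_or.
move=> /and4P[/and3P[i01 i02 i03] /andP[i12 i13] i23 _].
apply: (fourth_power idI special_dy special_dx) => [j ji|h3 u hu].
  by apply: special_vanish; rewrite eq_sym.
have := special_g_mul (u * Y i ^+ 2) => H.
have m2 : I (mixed_coef i3 i2 (slopes r d i3) * (Y i3 * Y i2) * (u * Y i ^+ 2)).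
  have i32 : i3 != i2 by rewrite eq_sym.
  have : I (mixed_coef i3 i2 (slopes r d i3) * u * (Y i ^+ 2 * (Y i3 * Y i2))).
    by apply: (mixed2_mul i32 hu); rewrite /deg; clear; lia.
  by congr I; ring.
have m1 : I (mixed_coef i3 i1 (rev (slopes r d i3)) * (Y i3 * Y i1) * (u * Y i ^+ 2)).
  have i31 : i3 != i1 by rewrite eq_sym.
  have : I (mixed_coef i3 i1 (rev (slopes r d i3)) * u * (Y i ^+ 2 * (Y i3 * Y i1))).
    by apply: (mixed1_mul i31 hu); rewrite /deg; clear; lia.
  by congr I; ring.
move: (ideal_addr idI (idealD idI m2 m1) H).
rewrite mulr_suml (bigD1 i) //= {1}/square_coef h3 => {}H.
suff : I (line 0 ^+ (3 * d + R + 2 * r i - 3) * Y i ^+ 2 * (u * Y i ^+ 2)) by congr I; ring.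
apply: (ideal_addr idI _ H); apply: (ideal_sum idI) => j ji.
case: (xform_square_coef j) => [->|[m hm hs]].
  by rewrite !mul0r; exact: ideal0.
have ij : i != j by rewrite eq_sym.
have := mixed_squares idI special_dy ij (special_vanish ij) (n := (m + deg r d i)%N)
  (w := square_coef j * u).
move=> h; have : I (square_coef j * u * (Y i ^+ 2 * Y j ^+ 2)).
  apply: h; last exact: xformM.
  by rewrite /deg; lia.
by congr I; ring.
Qed.

Lemma special_quartic i j l m n w : (n + 3 = 4 * d + R + (r i + r j + r l + r m))%N ->
  xform n w -> I (w * (Y i * Y j * Y l * Y m)).
Proof.
move=> hn hw.
have h4 x : (n + 3 = 4 * d + R + 4 * r x)%N -> I (w * Y x ^+ 4).
  by move=> h; exact: special_fourth h hw.
have h22 x y : x != y -> (n + 3 = 4 * d + R + (2 * r x + 2 * r y))%N ->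
    I (w * (Y x ^+ 2 * Y y ^+ 2)).
  by move=> xy h; exact: (mixed_squares idI special_dy xy (special_vanish xy) h hw).
have h211 x y z : x != y -> (n + 3 = 4 * d + R + (2 * r z + (r x + r y)))%N ->
    I (w * (Y z ^+ 2 * (Y x * Y y))).
  by move=> xy h; exact: (special_odd xy h hw).
have [ij|ij] := eqVneq i j; have [lm|lm] := eqVneq l m.
- have [il|il] := eqVneq i l.
    have : I (w * Y i ^+ 4) by apply: h4; move: hn; rewrite -lm -ij -il; lia.
    by congr (I (_ * _)); rewrite -lm -ij -il; ring.
  have : I (w * (Y i ^+ 2 * Y l ^+ 2)) by apply: h22 => //; move: hn; rewrite -lm -ij; lia.
  by congr (I (_ * _)); rewrite -lm -ij; ring.
- have : I (w * (Y i ^+ 2 * (Y l * Y m))) by apply: h211 => //; move: hn; rewrite -ij; lia.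
  by congr (I (_ * _)); rewrite -ij; ring.
- have : I (w * (Y l ^+ 2 * (Y i * Y j))) by apply: h211 => //; move: hn; rewrite -lm; lia.
  by congr (I (_ * _)); rewrite -lm; ring.
have [il|il] := eqVneq i l.
  have : I (w * (Y i ^+ 2 * (Y j * Y m))).
    have [jm|jm] := eqVneq j m.
      have : I (w * (Y i ^+ 2 * Y j ^+ 2)) by apply: h22 => //; move: hn; rewrite -jm -il; lia.
      by congr (I (_ * _)); rewrite -jm; ring.
    by apply: h211 => //; move: hn; rewrite -il; lia.
  by congr (I (_ * _)); rewrite -il; ring.
have := support3 idI special_dy ij il.
have [jl|jl] := eqVneq j l => [_|/(_ m n w isT hn hw)//].
have [im|im] := eqVneq i m.
  have : I (w * (Y i ^+ 2 * Y j ^+ 2)) by apply: h22 => //; move: hn; rewrite -jl -im; lia.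
  by congr (I (_ * _)); rewrite -jl -im; ring.
have : I (w * (Y j ^+ 2 * (Y i * Y m))) by apply: h211 => //; move: hn; rewrite -jl; lia.
by congr (I (_ * _)); rewrite -jl; ring.
Qed.

Lemma special_contains (t : int) h : t = 4 * d%:Z - 3 + R%:Z ->
  bihomog r t 4 h -> I h.
Proof.
move=> ht /allP hh; rewrite [h]mpolyE; apply: (ideal_sum_seq idI) => u /hh /eqP hu _.
apply: (idealZ _ idI).
have [i [u1 [-> hu1]]] := bidegree_y_factor (n := 3) hu.
have [j [u2 [-> hu2]]] := bidegree_y_factor (n := 2) hu1.
have [l [u3 [-> hu3]]] := bidegree_y_factor (n := 1) hu2.
have [m [u4 [-> hu4]]] := bidegree_y_factor (n := 0) hu3.
have [n hn] : exists n : nat, t + (r i)%:Z + (r j)%:Z + (r l)%:Z + (r m)%:Z = n.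
  have := hu4; rewrite /bidegree => -[<- /eqP hy].
  have {}hy k : u4 (yi k) = 0%N.
    by move: hy; rewrite -(raddf_sum Posz) eqz_nat sum_nat_eq0 => /forallP/(_ k)/eqP.
  exists (\sum_(k < 3) u4 (xi k))%N; rewrite (raddf_sum Posz) [X in _ - X]big1 ?subr0 //.
  by move=> k _; rewrite hy mulr0.
have := @special_quartic i j l m n 'X_[u4].
rewrite !mpolyXD => H; have := H _ _; rewrite mulrC -!mulrA; apply.
  by move: hn; rewrite ht; clear; lia.
by apply: bihomogX; rewrite hu4 hn.
Qed.

End SpecialPair.

(** * Conclusion *)

Lemma sorted_enumeration (r : 'I_4 -> nat) : exists i0 i1 i2 i3,
  [/\ perm_eq [:: i0; i1; i2; i3] (enum 'I_4), (r i0 <= r i1)%N, (r i1 <= r i2)%N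
    & (r i2 <= r i3)%N].
Proof.
have := sort_sorted (fun i j => leq_total (r i) (r j)) (enum 'I_4).
have := permEl (perm_sort (fun i j => r i <= r j)%N (enum 'I_4)).
have := size_sort (fun i j => r i <= r j)%N (enum 'I_4); rewrite size_enum_ord.
case: (sort _ _) => [|i0 [|i1 [|i2 [|i3 []]]]] //= _ he.
by rewrite !andbT => /and3P[? ? ?]; exists i0, i1, i2, i3.
Qed.

Theorem proposition6 (R : realType) (r : 'I_4 -> nat) (d : nat) (t : int)
    (ht : t = 4 * d%:Z - 3 + \sum_(j < 4) (r j)%:Z) :
  @for_general R[i] ({mpoly R[i][3 + 4]} * {mpoly R[i][3 + 4]})%type
    (fun fg => bihomog r d%:Z 2 fg.1 /\ bihomog r (t - d%:Z) 2 fg.2)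
    (fun fg => forall h : {mpoly R[i][3 + 4]},
       bihomog r t 4 h -> in_ideal_gen (generators fg.1 fg.2) h).
Proof.
have {}ht : t = 4 * d%:Z - 3 + (\sum_(j < 4) r j)%N%:Z by rewrite ht (raddf_sum Posz).
have [i0 [i1 [i2 [i3 [enum4 r01 r12 r23]]]]] := sorted_enumeration r.
apply: (for_general_of_witness
  (v0 := (special_f R[i] r d, special_g R[i] r d i1 i2 i3))) => /=.
- split; first exact: special_f_bihomog.
  have := special_g_bihomog R[i] d enum4 r01 r12 r23.
  by congr (is_true (bihomog _ _ _ _)); rewrite ht; lia.
- by move=> h; apply: (special_contains enum4 r01 r12 r23 ht).
Qed.
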